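(* Let $n\ge2$ be an integer and let $F\in M_n(\mathbb{C})$ be a matrix such that $F\overline{F}=c\mathds{1}$ for some $c\in\mathbb{R}\setminus\{0\}$. Let $M:=L^\infty(O_F^+)$, let $N$ be the even von Neumann subalgebra of $M$, and let $\mathbb{E}_N:M\to N$ be the faithful normal conditional expectation preserving the Haar state. Then the inclusion $N\subseteq M$, i.e. the triple $(M,N,\mathbb{E}_N)$, has the relative Haagerup property.
   Context: $\mathrm{Pol}(O_F^+)$ is the universal unital $*$-algebra generated by the entries $u_{ij}$ ($1\le i,j\le n$) of a unitary matrix $U$ subject to $U=F\overline{U}F^{-1}$, where $(\overline{U})_{ij}=u_{ij}^*$. With the comultiplication determined by $\Delta(u_{ij})=\sum_{k=1}^nu_{ik}\otimes u_{kj}$ it is a Hopf $*$-algebra, which defines a compact quantum group $O_F^+$ (free orthogonal quantum group). It has a Haar state $h$, and $L^\infty(O_F^+)$ is the von Neumann algebra generated by $\mathrm{Pol}(O_F^+)$ in the GNS representation of $h$; $h$ extends to a faithful normal state on it. The even subalgebra $N$ of $M=L^\infty(O_F^+)$ is the von Neumann subalgebra generated by the elements $u_{ij}u_{kl}$, $1\le i,j,k,l\le n$; there is a faithful normal $h$-preserving conditional expectation $\mathbb{E}_N:M\to N$. For a faithful normal positive functional $\varphi$ on a von Neumann algebra $M$, $L^2(M,\varphi)$ is the GNS Hilbert space with cyclic vector $\Omega_\varphi$, and $M\subseteq \mathcal{B}(L^2(M,\varphi))$. A linear map $\Phi:M\to M$ has an $L^2$-implementation $\Phi^{(2)}$ with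 respect to $\varphi$ if $x\Omega_\varphi\mapsto\Phi(x)\Omega_\varphi$ extends to a bounded operator $\Phi^{(2)}$ on $L^2(M,\varphi)$. Let $N\subseteq M$ be a unital inclusion with a faithful normal conditional expectation $\mathbb{E}_N:M\to N$ and let $\varphi$ be a faithful normal positive functional on $M$ with $\varphi\circ\mathbb{E}_N=\varphi$. Let $e_N=\mathbb{E}_N^{(2)}$ be the orthogonal projection of $L^2(M,\varphi)$ onto the closure of $N\Omega_\varphi$, and let $\mathcal{K}(M,N,\varphi)$ be the operator-norm closure of $\mathrm{Span}\{xe_Ny: x,y\in M\}$. The triple $(M,N,\mathbb{E}_N)$ has the relative Haagerup property if for some (equivalently, any) such $\varphi$ there is a net $(\Phi_i)_{i\in I}$ of normal maps $\Phi_i:M\to M$ such that: (1) each $\Phi_i$ is completely positive and $\sup_i\|\Phi_i\|<\infty$; (2) each $\Phi_i$ is an $N$-$N$-bimodule map; (3) $\Phi_i(x)\to x$ strongly for every $x\in M$; (4) $\varphi\circ\Phi_i\le\varphi$ for all $i$; (5) $\Phi_i^{(2)}\in\mathcal{K}(M,N,\varphi)$ for all $i$. *)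

(* Defs.v *)
From HB Require Import structures.
From mathcomp Require Import all_boot all_order all_algebra complex.
From mathcomp Require Import boolp classical_sets functions reals.
From mathcomp Require Import topology normedtype sequences.

Set Implicit Arguments.
Unset Strict Implicit.
Unset Printing Implicit Defensive.

Import Order.TTheory GRing.Theory Num.Theory Num.Def.
Import numFieldNormedType.Exports.
Local Open Scope classical_set_scope.
Local Open Scope ring_scope.

(* The scalar field [C] is kept abstract below because the topology of a
   numFieldType is only inferred for abstract ones; it is meant to be [R[i]]
   for a [R : realType]. *)

(* An [algType] is nontrivial; Pol(O_F^+) is, since it has a counit. *)
Record starAlg (C : numClosedFieldType) := StarAlg {
  star_sort :> algType C ;
  star : star_sort -> star_sort ;
  starD : forall a b, star (a + b) = star a + star b ;
  starZ : forall (k : C) a, star (k *: a) = k^* *: star a ;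
  starM : forall a b, star (a * b) = star b * star a ;
  starK : involutive star }.

Definition star_morphism (C : numClosedFieldType) (A B : starAlg C)
    (f : {lrmorphism A -> B}) : Prop :=
  forall a, f (star a) = star (f a).

Definition mxbar (C : numClosedFieldType) (A : starAlg C) n (U : 'M[A]_n) :
  'M[A]_n := map_mx (@star C A) U.

Definition orthogonal_relations (C : numClosedFieldType) n (F : 'M[C]_n)
    (A : starAlg C) (U : 'M[A]_n) : Prop :=
  [/\ U *m (mxbar U)^T = 1%:M,
      (mxbar U)^T *m U = 1%:M &
      U = map_mx (in_alg A) F *m mxbar U *m map_mx (in_alg A) (invmx F)].

(* [A], with the matrix [U] of generators, is the universal such *-algebra;
   uniqueness of [f] says that the entries of [U] generate [A]. *)
Definition is_Pol_OF (C : numClosedFieldType) n (F : 'M[C]_n)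
    (A : starAlg C) (U : 'M[A]_n) : Prop :=
  orthogonal_relations F U /\
  forall (B : starAlg C) (V : 'M[B]_n), orthogonal_relations F V ->
    exists f : {lrmorphism A -> B},
      [/\ star_morphism f, map_mx f U = V &
          forall g : {lrmorphism A -> B},
            star_morphism g -> map_mx g U = V -> g =1 f].

(* [t a b] is the elementary tensor of [a] and [b] in [T], the algebraic tensor
   product of [A] and [B]. *)
Definition is_tensor_product (C : numClosedFieldType) (A B T : starAlg C)
    (t : {bilinear A -> B -> T}) : Prop :=
  [/\ t 1 1 = 1,
      (forall a b a' b', t a b * t a' b' = t (a * a') (b * b')),
      (forall a b, star (t a b) = t (star a) (star b)) &
      forall (V : lmodType C) (s : {bilinear A -> B -> V}),
        exists f : {linear T -> V},
          (forall a b, f (t a b) = s a b) /\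
          forall g : {linear T -> V},
            (forall a b, g (t a b) = s a b) -> g =1 f].

Definition is_comultiplication (C : numClosedFieldType) n
    (A T : starAlg C) (U : 'M[A]_n) (t : {bilinear A -> A -> T})
    (Delta : {lrmorphism A -> T}) : Prop :=
  star_morphism Delta /\
  forall i j, Delta (U i j) = \sum_(k < n) t (U i k) (U k j).

(* The slice maps [L] of [h] exist and are unique when [t] is a tensor
   product. *)
Definition is_haar_state (C : numClosedFieldType) (A T : starAlg C)
    (t : {bilinear A -> A -> T}) (Delta : {lrmorphism A -> T})
    (h : {scalar A}) : Prop :=
  [/\ h 1 = 1,
      (forall a, 0 <= h (star a * a)),
      (forall L : {linear T -> A}, (forall a b, L (t a b) = h a *: b) ->
         forall a, L (Delta a) = h a *: 1) &
      (forall L : {linear T -> A}, (forall a b, L (t a b) = h b *: a) ->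
         forall a, L (Delta a) = h a *: 1)].

(* The inner product is linear in its first argument. *)
Record hilbert (C : numClosedFieldType) := Hilbert {
  hilbert_sort :> completeNormedModType C ;
  inner : {dot hilbert_sort for conjC} ;
  norm_innerE : forall x : hilbert_sort, `|x| ^+ 2 = inner x x }.
Arguments inner {C h}.

Section Operators.
Context {C : numClosedFieldType} {H : hilbert C}.
Implicit Types (S T x y : H -> H) (M N : set (H -> H)).

Definition op_bound T (k : C) : Prop := forall xi, `|T xi| <= k * `|xi|.

Definition bounded_op : set (H -> H) :=
  [set T | (forall (k : C) xi eta, T (k *: xi + eta) = k *: T xi + T eta) /\
           exists k, op_bound T k].

Definition adjoint S T : Prop :=
  forall xi eta, inner (S xi) eta = inner xi (T eta).

Definition positive_op T : Prop := forall xi, 0 <= inner (T xi) xi.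

Definition commutant (S : set (H -> H)) : set (H -> H) :=
  [set T | bounded_op T /\ forall s, S s -> T \o s = s \o T].

(* The algebra operations and the unit are inherited from the bicommutant. *)
Definition von_neumann_algebra M : Prop :=
  [/\ M `<=` bounded_op,
      (forall x y, M x -> adjoint x y -> M y) &
      commutant (commutant M) = M].

Definition vn_generated (S : set (H -> H)) : set (H -> H) :=
  smallest von_neumann_algebra S.

Definition linear_on M (V : lmodType C) (f : (H -> H) -> V) : Prop :=
  forall (k : C) x y, M x -> M y -> f (k *: x + y) = k *: f x + f y.

(* The sigma-weakly continuous functionals on B(H): the sums of
   <T xi_k, eta_k> with square-summable [xi] and [eta]. *)
Definition sigma_weak_functional (w : (H -> H) -> C) : Prop :=
  exists xi eta : nat -> H,
    [/\ cvgn (series (fun k => `|xi k| ^+ 2)),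
        cvgn (series (fun k => `|eta k| ^+ 2)) &
        forall T, bounded_op T ->
          series (fun k => inner (T (xi k)) (eta k)) @ \oo --> w T].

(* [f] restricted to [M] belongs to the predual of [M]. *)
Definition normal_functional M (f : (H -> H) -> C) : Prop :=
  exists2 w, sigma_weak_functional w & forall x, M x -> f x = w x.

(* Sigma-weak continuity of [Phi] on [M]. *)
Definition normal_map M (Phi : (H -> H) -> (H -> H)) : Prop :=
  forall w, sigma_weak_functional w -> normal_functional M (w \o Phi).

Definition faithful_normal_positive_functional M
    (phi : (H -> H) -> C^o) : Prop :=
  [/\ linear_on M phi,
      (forall x, M x -> positive_op x -> 0 <= phi x),
      (forall x, M x -> positive_op x -> phi x = 0 -> x = 0) &
      normal_functional M phi].

(* An m x m matrix [X] over [M] is an operator on the m-th power of [H]. *)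
Definition completely_positive M (Phi : (H -> H) -> (H -> H)) : Prop :=
  forall m (X : 'I_m -> 'I_m -> (H -> H)), (forall i j, M (X i j)) ->
    (forall xi : 'I_m -> H,
       0 <= \sum_i \sum_j inner (X i j (xi j)) (xi i)) ->
    (forall xi : 'I_m -> H,
       0 <= \sum_i \sum_j inner (Phi (X i j) (xi j)) (xi i)).

Definition bimodule_map M N (Phi : (H -> H) -> (H -> H)) : Prop :=
  forall a b x, N a -> N b -> M x ->
    Phi (a \o x \o b) = a \o Phi x \o b.

Definition map_bound M (Phi : (H -> H) -> (H -> H)) (K : C) : Prop :=
  forall x k, M x -> op_bound x k -> op_bound (Phi x) (K * k).

Definition faithful_normal_conditional_expectation M N
    (E : (H -> H) -> (H -> H)) : Prop :=
  [/\ linear_on M E /\ (forall x, M x -> N (E x)),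
      (forall x, N x -> E x = x),
      bimodule_map M N E,
      (forall x, M x -> positive_op x -> positive_op (E x)) &
      (forall x, M x -> positive_op x -> E x = 0 -> x = 0) /\
      normal_map M E].

Definition op_span (S : set (H -> H)) : set (H -> H) :=
  [set T | exists m (k : 'I_m -> C) (s : 'I_m -> (H -> H)),
     (forall i, S (s i)) /\ T = \sum_i k i *: s i].

Definition op_norm_closure (S : set (H -> H)) : set (H -> H) :=
  [set T | bounded_op T /\
     forall e : C, 0 < e -> exists2 s, S s & op_bound (T - s) e].

End Operators.

Definition is_gns_star (C : numClosedFieldType) (A : starAlg C) (h : A -> C)
    (H : hilbert C) (pi : A -> (H -> H)) (Omega : H) : Prop :=
  [/\ (forall a, bounded_op (pi a)) /\
      (forall (k : C) a b, pi (k *: a + b) = k *: pi a + pi b),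
      pi 1 = id /\ (forall a b, pi (a * b) = pi a \o pi b),
      (forall a, adjoint (pi a) (pi (star a))),
      (forall a, inner (pi a Omega) Omega = h a) &
      dense (range (fun a => pi a Omega))].

Section RelativeHaagerup.
Context {C : numClosedFieldType} {H : hilbert C}.
Implicit Types (M N : set (H -> H)).

(* [K], with the action [lam] of [M] and the cyclic vector [Omega], is
   L^2(M, phi). *)
Definition is_gns_vn M (phi : (H -> H) -> C)
    (K : hilbert C) (lam : (H -> H) -> (K -> K)) (Omega : K) : Prop :=
  [/\ (forall x, M x -> bounded_op (lam x)) /\ linear_on M lam,
      lam id = id /\
      (forall x y, M x -> M y -> lam (x \o y) = lam x \o lam y),
      (forall x y, M x -> M y -> adjoint x y -> adjoint (lam x) (lam y)),
      (forall x, M x -> inner (lam x Omega) Omega = phi x) &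
      dense [set lam x Omega | x in M]].

Definition is_L2_implementation M (K : hilbert C) (lam : (H -> H) -> (K -> K))
    (Omega : K) (Phi : (H -> H) -> (H -> H)) (T : K -> K) : Prop :=
  bounded_op T /\ forall x, M x -> T (lam x Omega) = lam (Phi x) Omega.

(* The set K(M, N, phi); the L^2-implementation [e] of [E] is e_N. *)
Definition relative_compacts M (E : (H -> H) -> (H -> H)) (K : hilbert C)
    (lam : (H -> H) -> (K -> K)) (Omega : K) : set (K -> K) :=
  op_norm_closure (op_span
    [set T | exists x y e, [/\ M x, M y,
       is_L2_implementation M lam Omega E e & T = lam x \o e \o lam y]]).

Definition directed (I : Type) (le : I -> I -> Prop) : Prop :=
  [/\ inhabited I, (forall i, le i i),
      (forall i j k, le i j -> le j k -> le i k) &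
      forall i j, exists k, le i k /\ le j k].

Definition net_cvg (I : Type) (le : I -> I -> Prop) (V : topologicalType)
    (f : I -> V) (l : V) : Prop :=
  forall B, nbhs l B -> exists i0, forall i, le i0 i -> B (f i).

(* L^2(M, phi) is determined up to unitary equivalence, so it does not matter
   that it is quantified existentially. *)
Definition relative_Haagerup_property M N
    (E : (H -> H) -> (H -> H)) : Prop :=
  exists phi : (H -> H) -> C^o,
    [/\ faithful_normal_positive_functional M phi,
        (forall x, M x -> phi (E x) = phi x) &
    exists (K : hilbert C) (lam : (H -> H) -> (K -> K)) (Omega : K),
      is_gns_vn M phi lam Omega /\
    exists (I : Type) (le : I -> I -> Prop) (Phi : I -> (H -> H) -> (H -> H)),
      [/\ directed le,
          (forall i, [/\ linear_on M (Phi i),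
             (forall x, M x -> M (Phi i x)) & normal_map M (Phi i)]),
          (forall i, completely_positive M (Phi i)) /\
          (exists k, forall i, map_bound M (Phi i) k),
          (forall i, bimodule_map M N (Phi i)) &
      [/\ (forall x, M x -> forall zeta : K,
             net_cvg le (fun i => lam (Phi i x) zeta) (lam x zeta)),
          (forall i x, M x -> positive_op x -> phi (Phi i x) <= phi x) &
          (forall i, exists2 T, is_L2_implementation M lam Omega (Phi i) T &
             relative_compacts M E lam Omega T)]]].

End RelativeHaagerup.

Section FreeOrthogonal.
Context {C : numClosedFieldType} {A : starAlg C} {H : hilbert C}.

Definition Linfty (pi : A -> (H -> H)) : set (H -> H) :=
  vn_generated (range pi).

Definition even_Linfty n (U : 'M[A]_n) (pi : A -> (H -> H)) : set (H -> H) :=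
  vn_generated [set x | exists i j k l, x = pi (U i j * U k l)].

(* The normal extension to L^infty of the state of which ([pi], [Omega]) is the
   GNS representation is the vector state of [Omega]. *)
Definition vector_state (Omega : H) (x : H -> H) : C := inner (x Omega) Omega.

End FreeOrthogonal.

(* Main.v *)
Require Import Defs.
From HB Require Import structures.
From mathcomp Require Import all_boot all_order all_algebra complex.
From mathcomp Require Import boolp classical_sets functions reals.
From mathcomp Require Import topology normedtype sequences.

(* The inclusion has index 2: N is the fixed point algebra of the symmetry
   alpha : u_ij |-> - u_ij, implemented on L^2 by a self-adjoint unitary V, and
   e_N = (1 + V) / 2.  Since the u_ij are odd and \sum_j u_1j u_1j^* = 1, one has
   \sum_j u_1j e_N u_1j^* = (1 - V) / 2, so 1 = e_N + \sum_j u_1j e_N u_1j^*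
   lies in the span of M e_N M, and the constant net of identity maps works.

   The other ingredient is that the Haar state is faithful on M.  For W = F^* F,
   invariance shows that the functional
     a |-> \sum_(r, s) W_rs h (u_ir^* a u_ks)
   is a multiple of h.  For i = k this makes right multiplication by the
   generators bounded on L^2; in general it produces, for each b in Pol, some b'
   with h (b a) = h (a b') for all a, hence an adjoint of right multiplication.
   These operators commute with M and move Omega to a dense set, so Omega is
   separating. *)

Import GRing.Theory Num.Theory Num.Def.
Local Open Scope ring_scope.

Import Order.TTheory numFieldNormedType.Exports.
Set Implicit Arguments.
Unset Strict Implicit.
Unset Printing Implicit Defensive.
Local Open Scope classical_set_scope.

(** * Operators on Hilbert spaces *)

Section Hilbert.
Context {C : numClosedFieldType} {H : hilbert C}.
Implicit Types (S T x y : H -> H) (xi eta zeta : H) (M : set (H -> H)).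

Lemma innerDl xi eta zeta :
  inner (xi + eta) zeta = inner xi zeta + inner eta zeta.
Proof. exact: linearDl. Qed.

Lemma innerDr xi eta zeta :
  inner zeta (xi + eta) = inner zeta xi + inner zeta eta.
Proof. exact: linearDr. Qed.

Lemma innerZl k xi eta : inner (k *: xi) eta = k * inner xi eta.
Proof. exact: linearZl_LR. Qed.

Lemma innerZr k xi eta : inner xi (k *: eta) = k^* * inner xi eta.
Proof. exact: linearZr_LR. Qed.

Lemma innerC xi eta : inner xi eta = (inner eta xi)^*.
Proof. by rewrite (hermC (@inner C H)) expr0 mul1r. Qed.

Lemma inner0l xi : inner 0 xi = 0.
Proof. exact: linear0l. Qed.

Lemma inner0r xi : inner xi 0 = 0.
Proof. exact: linear0r. Qed.

Lemma innerNl xi eta : inner (- xi) eta = - inner xi eta.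
Proof. by rewrite -scaleN1r innerZl mulN1r. Qed.

Lemma innerNr xi eta : inner xi (- eta) = - inner xi eta.
Proof. by rewrite -scaleN1r innerZr rmorphN1 mulN1r. Qed.

Lemma inner_eq0 xi : inner xi xi = 0 -> xi = 0.
Proof.
by rewrite -norm_innerE => /eqP; rewrite expf_eq0 /= normr_eq0 => /eqP.
Qed.

Lemma inner_inj xi eta : (forall zeta, inner xi zeta = inner eta zeta) ->
  xi = eta.
Proof.
move=> E; apply/eqP; rewrite -subr_eq0; apply/eqP/inner_eq0.
by rewrite {1}innerDl innerNl E subrr.
Qed.

Lemma inner_CauchySchwarz xi eta : `|inner xi eta| <= `|xi| * `|eta|.
Proof.
have [->|nz] := eqVneq eta 0; first by rewrite inner0r !normr0 mulr0.
have p0 : 0 < `|eta| by rewrite normr_gt0.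
have e0 : inner eta eta != 0 by rewrite -norm_innerE expf_neq0 // gt_eqF.
pose k := inner xi eta / inner eta eta.
have kE : k * inner eta eta = inner xi eta by rewrite divfK.
have : 0 <= inner (xi - k *: eta) (xi - k *: eta).
  by rewrite -norm_innerE exprn_ge0.
have -> : inner (xi - k *: eta) (xi - k *: eta) =
    inner xi xi - k * (inner xi eta)^*.
  have o : inner (xi - k *: eta) eta = 0.
    by rewrite innerDl innerNl innerZl kE subrr.
  rewrite innerDr innerNr innerZr o mulr0 oppr0 addr0 innerDl innerNl innerZl.
  by rewrite [inner eta xi]innerC.
have -> : k * (inner xi eta)^* = `|inner xi eta| ^+ 2 / `|eta| ^+ 2.
  by rewrite /k norm_innerE normCK mulrAC.
rewrite subr_ge0 ler_pdivrMr ?exprn_gt0 // -norm_innerE -exprMn.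
by rewrite ler_pXn2r // nnegrE ?mulr_ge0.
Qed.

(** The constant in [bounded_op] is an arbitrary scalar. A nonzero vector forces it to be
    nonnegative, and adding 1 makes it positive; on the zero space any constant will do. *)
Lemma op_bound_pos T : bounded_op T -> exists2 k, 0 < k & op_bound T k.
Proof.
move=> [_ [k kT]]; have [[xi nz]|triv] := pselect (exists xi : H, xi != 0).
  exists (k + 1); last first.
    move=> eta; rewrite mulrDl mul1r; apply: le_trans (kT eta) _.
    by rewrite lerDl.
  rewrite ltr_wpDl // -(@pmulr_lge0 _ `|xi|) ?normr_gt0 //.
  exact: le_trans (kT xi).
exists 1 => // xi; have -> : T xi = 0.
  by apply: contrapT => /eqP nz; apply: triv; exists (T xi).
by rewrite normr0 mul1r.
Qed.

Lemma norm_small_eq0 (V : normedZmodType C) (v : V) (K : C) :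
  0 < K -> (forall e, 0 < e -> `|v| <= K * e) -> v = 0.
Proof.
move=> K0 small; apply/eqP; rewrite -normr_le0; apply/ler_addgt0Pr => e e0.
by rewrite add0r; have := small _ (divr_gt0 e0 K0); rewrite mulrC divfK ?gt_eqF.
Qed.

Lemma dense_norm (D : set H) : dense D -> forall xi (e : C), 0 < e ->
  exists2 d, D d & `|d - xi| < e.
Proof.
move=> dD xi e e0.
have [|d [Bd Dd]] := dD (ball xi e)^° _ (@open_interior _ _).
  by exists xi; apply: (nbhsx_ballx xi e e0).
exists d => //; have := interior_subset Bd.
by rewrite -ball_normE /= distrC.
Qed.

Section Linear.
Variable T : H -> H.
Hypothesis bT : bounded_op T.

Lemma opP k xi eta : T (k *: xi + eta) = k *: T xi + T eta.
Proof. by case: bT => + _; apply. Qed.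

Lemma opD xi eta : T (xi + eta) = T xi + T eta.
Proof. by have := opP 1 xi eta; rewrite !scale1r. Qed.

Lemma op0 : T 0 = 0.
Proof.
apply/eqP; have /eqP := opD 0 0.
by rewrite addr0 -subr_eq0 opprD addNKr oppr_eq0.
Qed.

Lemma opZ k xi : T (k *: xi) = k *: T xi.
Proof. by have := opP k xi 0; rewrite op0 !addr0. Qed.

Lemma opB xi eta : T (xi - eta) = T xi - T eta.
Proof. by rewrite opD -scaleN1r opZ scaleN1r. Qed.

End Linear.

Lemma bounded_id : bounded_op (@idfun H).
Proof. by split=> //; exists 1 => xi; rewrite mul1r. Qed.

Lemma bounded_comp S T : bounded_op S -> bounded_op T -> bounded_op (S \o T).
Proof.
move=> bS bT; split=> [k xi eta /=|]; first by rewrite (opP bT) (opP bS).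
have [s s0 sS] := op_bound_pos bS; have [t t0 tT] := op_bound_pos bT.
exists (s * t) => xi /=; rewrite -mulrA.
by apply: le_trans (sS _) _; rewrite ler_pM2l.
Qed.

Lemma bounded_lin k S T : bounded_op S -> bounded_op T ->
  bounded_op (k *: S + T).
Proof.
move=> bS bT; split=> [l xi eta|].
  rewrite !fctE (opP bT) (opP bS) !scalerDr !scalerA (mulrC k).
  by rewrite !addrA; congr (_ + _); rewrite addrAC.
have [s s0 sS] := op_bound_pos bS; have [t t0 tT] := op_bound_pos bT.
exists (`|k| * s + t) => xi; rewrite !fctE mulrDl.
apply: le_trans (ler_normD _ _) _; apply: lerD => //.
by rewrite normrZ -mulrA ler_wpM2l.
Qed.

(** For [d] in [D] close to [xi], [f xi] equals [f (xi - d)], which is small. All the density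
    arguments on operators and inner products below reduce to this. *)
Lemma dense_eq0 (V : normedZmodType C) (D : set H) (f : H -> V) (K : C) :
  dense D -> (forall xi eta, f (xi - eta) = f xi - f eta) ->
  0 <= K -> (forall xi, `|f xi| <= K * `|xi|) ->
  (forall d, D d -> f d = 0) -> forall xi, f xi = 0.
Proof.
move=> dD fB K0 fK f0 xi; apply: (@norm_small_eq0 _ _ (K + 1)) => [|e e0].
  by rewrite ltr_wpDl.
have [d Dd de] := dense_norm dD xi e0.
rewrite -[f xi]opprK normrN -[- f xi]add0r -(f0 _ Dd) -fB.
apply: le_trans (fK _) _; rewrite mulrDl mul1r.
by apply: (le_trans (ler_wpM2l K0 (ltW de))); rewrite lerDl ltW.
Qed.

Lemma eq_op_dense (D : set H) S T : dense D -> bounded_op S -> bounded_op T ->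
  (forall xi, D xi -> S xi = T xi) -> S = T.
Proof.
move=> dD bS bT E; apply/funext => xi; apply/eqP; rewrite -subr_eq0; apply/eqP.
have [s s0 sS] := op_bound_pos bS; have [t t0 tT] := op_bound_pos bT.
apply: (@dense_eq0 _ D (fun xi => S xi - T xi) (s + t)) => //.
- by move=> eta zeta; rewrite (opB bS) (opB bT) !opprD addrACA.
- by rewrite addr_ge0 // ltW.
- move=> eta; apply: le_trans (ler_normB _ _) _.
  by rewrite mulrDl; apply: lerD.
- by move=> d /E ->; rewrite subrr.
Qed.

Lemma dense_orthogonal (D : set H) xi : dense D ->
  (forall d, D d -> inner xi d = 0) -> xi = 0.
Proof.
move=> dD orth; apply: inner_eq0.
apply: (@dense_eq0 _ D (inner xi) `|xi|) => //.
- by move=> eta zeta; rewrite innerDr innerNr.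
- by move=> eta; apply: inner_CauchySchwarz.
Qed.

Lemma adjoint_dense (D : set H) S T : dense D -> bounded_op S -> bounded_op T ->
  (forall d d', D d -> D d' -> inner (S d) d' = inner d (T d')) -> adjoint S T.
Proof.
move=> dD bS bT aST xi eta.
have [s s0 sS] := op_bound_pos bS; have [t t0 tT] := op_bound_pos bT.
have bound xi' eta' : `|inner (S xi') eta' - inner xi' (T eta')| <=
    (s + t) * (`|xi'| * `|eta'|).
  apply: le_trans (ler_normB _ _) _; rewrite mulrDl.
  apply: lerD; apply: le_trans (inner_CauchySchwarz _ _) _.
    by rewrite mulrA ler_wpM2r.
  by rewrite mulrCA ler_wpM2l.
have st0 : 0 <= s + t by rewrite addr_ge0 // ltW.
(* The identity is extended from [D] to [H] in the first variable, then in the second. *)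
have half d' : D d' -> forall xi', inner (S xi') d' - inner xi' (T d') = 0.
  move=> Dd'; apply: (@dense_eq0 _ D _ ((s + t) * `|d'|)) => //.
  - move=> x y; rewrite (opB bS) !innerDl !innerNl !opprD.
    by rewrite addrACA.
  - by rewrite mulr_ge0.
  - by move=> x; rewrite -mulrA [`|d'| * _]mulrC.
  - by move=> d Dd; rewrite aST // subrr.
apply/eqP; rewrite -subr_eq0; apply/eqP.
apply: (@dense_eq0 _ D (fun eta => inner (S xi) eta - inner xi (T eta))
  ((s + t) * `|xi|)) => //.
- move=> x y; rewrite (opB bT) !innerDr !innerNr !opprD.
  by rewrite addrACA.
- by rewrite mulr_ge0.
- by move=> x; rewrite -mulrA.
- by move=> d Dd; apply: half.
Qed.

Lemma adjoint_sym S T : adjoint S T -> adjoint T S.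
Proof. by move=> a xi eta; rewrite innerC -a -innerC. Qed.

(** The bound comes from [|T xi|^2 = <S (T xi), xi> <= s |T xi| |xi|]. *)
Lemma bounded_adjoint S T : bounded_op S -> adjoint S T -> bounded_op T.
Proof.
move=> bS aST; split=> [k xi eta|].
  apply: inner_inj => zeta.
  by rewrite !(adjoint_sym aST, innerDl, innerZl).
have [s s0 sS] := op_bound_pos bS; exists s => xi.
have [->|nz] := eqVneq (T xi) 0; first by rewrite normr0 mulr_ge0 // ltW.
have n0 : 0 < `|T xi| by rewrite normr_gt0.
rewrite -(ler_pM2r n0) -expr2 norm_innerE -aST -[inner _ _]ger0_norm; last first.
  by rewrite aST -norm_innerE exprn_ge0.
apply: le_trans (inner_CauchySchwarz _ _) _.
by rewrite mulrAC ler_wpM2r.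
Qed.

(* A positive sesquilinear form <T xi, xi> is nonnegative at
   xi + k *: eta for k = +-e, +-ie with e small; this forces
   the cross terms to vanish once the value at xi does. *)
Lemma positive_op_eq0 T xi : bounded_op T -> positive_op T ->
  inner (T xi) xi = 0 -> T xi = 0.
Proof.
move=> bT posT T0; apply: inner_inj => eta; rewrite inner0l.
set p := inner (T xi) eta; pose q := inner (T eta) xi.
have main k : 0 <= k^* * p + k * q + `|k| ^+ 2 * inner (T eta) eta.
  have := posT (xi + k *: eta).
  rewrite (opD bT) (opZ bT) innerDl !innerDr !innerZl !innerZr T0 add0r.
  by rewrite normCK -/p -/q addrA mulrA.
set s := inner (T eta) eta in main; have s0 : 0 <= s by apply: posT.
have cross (z a b : C) : `|z| = 1 -> a = z^* * p + z * q -> a = 0.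
  move=> nz aE; have step e : 0 < e -> 0 <= a + e * s /\ 0 <= - a + e * s.
    move=> e0; have ce : e^* = e by rewrite conj_Creal // gtr0_real.
    split.
      have := main (e * z); rewrite rmorphM /= ce normrM nz mulr1.
      by rewrite gtr0_norm // expr2 -!mulrA -!mulrDr pmulr_rge0 // -aE.
    have := main (- (e * z)); rewrite rmorphN rmorphM /= ce normrN normrM nz.
    rewrite mulr1 gtr0_norm // expr2 !mulNr -opprD -!mulrA -!mulrDr -mulrN.
    by rewrite -mulrDr pmulr_rge0 // -aE.
  have ar : a \is Num.real.
    have [+ _] := step 1 ltr01; rewrite mul1r => /ger0_real.
    by rewrite rpredDr // ger0_real.
  apply: (@norm_small_eq0 _ _ (s + 1)) => [|e e0]; first by rewrite ltr_wpDl.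
  have [h1 h2] := step e e0; apply: (@le_trans _ _ (e * s)); last first.
    by rewrite mulrC ler_pM2r // lerDl.
  rewrite real_ler_norml //; apply/andP; split; last by rewrite -subr_ge0 addrC.
  by rewrite -subr_ge0 opprK.
(* The choice [z = 1] gives [p + q = 0] and [z = 'i] gives [q = p], so [p = 0]. *)
have e1 := cross 1 _ 0 (normr1 _) erefl.
have ei := cross 'i _ 0 (normCi _) erefl.
move: ei; rewrite conjCi mulNr addrC -mulrBr => /eqP.
rewrite mulf_eq0 (negPf (neq0Ci _)) /= subr_eq0 => /eqP qp.
move: e1; rewrite rmorph1 !mul1r qp -mulr2n => /eqP.
by rewrite mulrn_eq0 /= => /eqP.
Qed.

End Hilbert.

(** * Extension of densely defined bounded operators *)

Section Extension.
Context {C : numClosedFieldType} {H : hilbert C} (A : lmodType C).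
Variables (D T0 : A -> H) (k : C).
Hypothesis linD : forall c a b, D (c *: a + b) = c *: D a + D b.
Hypothesis linT : forall c a b, T0 (c *: a + b) = c *: T0 a + T0 b.
Hypothesis densD : dense (range D).
Hypothesis boundT : forall a, `|T0 a| <= k * `|D a|.

Let extend_bound : exists2 K, 0 < K & forall a, `|T0 a| <= K * `|D a|.
Proof.
have [[a nz]|triv] := pselect (exists a, D a != 0).
  exists (k + 1); last first.
    by move=> b; apply: le_trans (boundT b) _; rewrite mulrDl mul1r lerDl.
  rewrite ltr_wpDl // -(@pmulr_lge0 _ `|D a|) ?normr_gt0 //.
  exact: le_trans (boundT a).
exists 1 => // a; have Da : D a = 0.
  by apply: contrapT => /eqP nz; apply: triv; exists a.
by have := boundT a; rewrite Da normr0 !mulr0.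
Qed.

Let linB (f : A -> H) : (forall c a b, f (c *: a + b) = c *: f a + f b) ->
  forall a b, f (a - b) = f a - f b.
Proof. by move=> lf a b; rewrite addrC -scaleN1r lf scaleN1r addrC. Qed.

(** The closure of the set of pairs [(D a, T0 a)]. It is the graph of the extension: the bound makes
    it single-valued, even if [D] is not injective, and density with completeness makes it total. *)
Let graph_closure (xi eta : H) : Prop := forall e : C, 0 < e ->
  exists a, `|D a - xi| < e /\ `|T0 a - eta| < e.

Let graph_closure_bound K xi eta : (forall a, `|T0 a| <= K * `|D a|) -> 0 < K ->
  graph_closure xi eta -> `|eta| <= K * `|xi|.
Proof.
move=> bK K0 g; apply/ler_addgt0Pr => e e0.
have K1 : 0 < K + 1 by rewrite addr_gt0.
have [a [aD aT]] := g _ (divr_gt0 e0 K1).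
rewrite -(subrK (T0 a) eta); apply: le_trans (ler_normD _ _) _.
rewrite addrC [`|eta - _|]distrC.
have : `|D a| <= `|xi| + e / (K + 1).
  rewrite -(subrK xi (D a)) addrC; apply: le_trans (ler_normD _ _) _.
  by rewrite lerD2l ltW.
rewrite -(ler_pM2l K0) => h.
(* The error [e] is shared between [xi], where it is amplified by [K], and [eta]. *)
have -> : e = K * (e / (K + 1)) + e / (K + 1).
  by rewrite -{2}(mul1r (e / _)) -mulrDl mulrCA mulfV ?mulr1 // gt_eqF.
rewrite addrA -mulrDr; apply: lerD; first exact: le_trans (bK a) h.
exact: ltW.
Qed.

Let graph_closure_lin c xi eta xi' eta' :
  graph_closure xi eta -> graph_closure xi' eta' ->
  graph_closure (c *: xi + xi') (c *: eta + eta').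
Proof.
move=> g g' e e0; have K0 : 0 < `|c| + 1 by rewrite ltr_wpDl.
have d0 := divr_gt0 e0 K0.
have [a [aD aT]] := g _ d0; have [b [bD bT]] := g' _ d0.
exists (c *: a + b).
suff main (u v u' v' : H) : `|u - v| < e / (`|c| + 1) ->
    `|u' - v'| < e / (`|c| + 1) -> `|c *: u + u' - (c *: v + v')| < e.
  by rewrite linD linT; split; apply: main.
move=> uv uv'; rewrite opprD addrACA -scalerBr.
apply: le_lt_trans (ler_normD _ _) _; rewrite normrZ.
have -> : e = `|c| * (e / (`|c| + 1)) + e / (`|c| + 1).
  by rewrite -{2}(mul1r (e / _)) -mulrDl mulrCA mulfV ?mulr1 // gt_eqF.
by apply: ler_ltD => //; rewrite ler_wpM2l // ltW.
Qed.

Let graph_closure_ex xi : exists eta, graph_closure xi eta.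
Proof.
have [K K0 bK] := extend_bound.
(* The sets [G e] form a filter base, since positive scalars are real and hence comparable; its
   image under [T0] is Cauchy and the limit is the value at [xi]. *)
pose G (e : C) := [set a | `|D a - xi| < e].
pose B := [set e : C | 0 < e].
have FG : ProperFilter (filter_from B G).
  apply: filter_from_proper => [|e e0].
    apply: filter_from_filter => [|e f e0 f0]; first by exists 1; apply: ltr01.
    have r : (e >=< f)%O by apply: real_comparable; apply: gtr0_real.
    by case/orP: r => ef; [exists e => // a ae|exists f => // a af];
      split=> //; apply: lt_le_trans ef.
  by have [_ [a _ <-] h] := dense_norm densD xi e0; exists a.
have c : cvg (T0 @ filter_from B G).
  apply: cauchy_cvg; apply/cauchyP => e e0.
  (* Two elements of [G (e / K / 2)] have images under [D] within [e / K], hence images under [T0]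
     within [e]. *)
  have d0 : 0 < e / K / 2 by rewrite !divr_gt0.
  have [_ [a _ <-] ha] := dense_norm densD xi d0.
  exists (T0 a); exists (e / K / 2) => // b hb; rewrite -ball_normE /=.
  rewrite -linB //; apply: le_lt_trans (bK _) _.
  rewrite linB // mulrC -ltr_pdivlMr // (splitr (e / K)).
  rewrite -(subrKA xi); apply: le_lt_trans (ler_normD _ _) _.
  by rewrite [`|xi - _|]distrC; apply: ltrD.
exists (lim (T0 @ filter_from B G)) => e e0.
have nb : nbhs (lim (T0 @ filter_from B G)) (ball (lim (T0 @ filter_from B G)) e).
  exact: nbhsx_ballx.
have [d d0 dG] := c _ nb.
have r : (e >=< d)%O by apply: real_comparable; apply: gtr0_real.
have [f [f0 fe fd]] : exists f, [/\ 0 < f, f <= e & f <= d].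
  by case/orP: r => ed; [exists e|exists d].
have [_ [a _ <-] ha] := dense_norm densD xi f0.
exists a; split; first exact: lt_le_trans fe.
by have := dG a (lt_le_trans ha fd); rewrite /= -ball_normE /= distrC.
Qed.

Lemma extend_bounded_op : exists2 T, bounded_op T & forall a, T (D a) = T0 a.
Proof.
have [K K0 bK] := extend_bound.
have [T gT] := choice graph_closure_ex.
have uniq xi eta eta' : graph_closure xi eta -> graph_closure xi eta' ->
    eta = eta'.
  move=> g g'; apply/eqP; rewrite -subr_eq0 -normr_le0.
  have := graph_closure_bound bK K0 (graph_closure_lin (-1) g' g).
  by rewrite !scaleN1r addNr normr0 mulr0 addrC.
exists T; first split.
- by move=> c xi eta; apply: uniq (gT _) _; apply: graph_closure_lin.
- by exists K => xi; apply: graph_closure_bound.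
- by move=> a; apply: uniq (gT _) _ => e e0; exists a; rewrite !subrr normr0.
Qed.

End Extension.

(** * Commutants and generated von Neumann algebras *)

Section VonNeumann.
Context {C : numClosedFieldType} {H : hilbert C}.
Implicit Types (R S T x y : H -> H) (M N : set (H -> H)).

Lemma commutant_bounded M : commutant M `<=` bounded_op.
Proof. by move=> x []. Qed.

Lemma commutant_comp M x y : commutant M x -> commutant M y ->
  commutant M (x \o y).
Proof.
move=> [bx cx] [by_ cy]; split=> [|s Ms]; first exact: bounded_comp.
by rewrite -compA (cy _ Ms) compA (cx _ Ms).
Qed.

Lemma commutant_lin M k x y : M `<=` bounded_op -> commutant M x ->
  commutant M y -> commutant M (k *: x + y).
Proof.
move=> bM [bx cx] [by_ cy]; split=> [|s Ms]; first exact: bounded_lin.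
apply/funext => xi; rewrite /= !fctE (opP (bM _ Ms)).
by rewrite -[x (s xi)]/((x \o s) xi) -[y (s xi)]/((y \o s) xi) cx // cy.
Qed.

Lemma commutant_id M : commutant M idfun.
Proof. by split=> [|s _]; [exact: bounded_id|]. Qed.

(** Stability under adjoints holds because [M] is self-adjoint, and the bicommutant condition is the
    identity M''' = M'. *)
Lemma commutant_von_neumann M : M `<=` bounded_op ->
  (forall x, M x -> exists2 y, M y & adjoint x y) ->
  von_neumann_algebra (commutant M).
Proof.
move=> bM aM; split; first exact: commutant_bounded.
  move=> x y [bx cx] axy; split=> [|s Ms]; first exact: bounded_adjoint axy.
  have [s' Ms' as'] := aM _ Ms; apply/funext => xi; apply: inner_inj => zeta.
  have ayx := adjoint_sym axy; have as_ := adjoint_sym as'.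
  rewrite /= ayx as' as' ayx.
  by rewrite -[x (s' _)]/((x \o s') _) cx.
apply/seteqP; split=> x [bx cx]; split=> // s Ms.
  by apply: cx; split=> [|t [_ ct]]; [apply: bM|rewrite ct].
by case: Ms => _ ct; rewrite ct //; split.
Qed.

Section Generated.
Variable S : set (H -> H).
Hypothesis bS : S `<=` bounded_op.

Lemma vn_generated_gen x : S x -> vn_generated S x.
Proof. by move=> Sx M [_]; apply. Qed.

Lemma vn_generated_id : vn_generated S idfun.
Proof. by move=> M [[_ _ <-] _]; apply: commutant_id. Qed.

Lemma vn_generated_comp x y : vn_generated S x -> vn_generated S y ->
  vn_generated S (x \o y).
Proof.
move=> Mx My M [[bM aM M2] SM].
have := Mx M (conj (And3 bM aM M2) SM); have := My M (conj (And3 bM aM M2) SM).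
by rewrite -M2 => ? ?; apply: commutant_comp.
Qed.

Lemma vn_generated_lin k x y : vn_generated S x -> vn_generated S y ->
  vn_generated S (k *: x + y).
Proof.
move=> Mx My M [[bM aM M2] SM].
have := Mx M (conj (And3 bM aM M2) SM); have := My M (conj (And3 bM aM M2) SM).
rewrite -M2 => ? ?; apply: commutant_lin => //.
exact: commutant_bounded.
Qed.

(** The set consisting of [R] and its adjoint [T] is self-adjoint, so its commutant is a von Neumann
    algebra; it contains [S], hence everything generated by [S]. *)
Lemma vn_generated_commute R T x : bounded_op R -> adjoint R T ->
  (forall s, S s -> s \o R = R \o s) -> (forall s, S s -> s \o T = T \o s) ->
  vn_generated S x -> x \o R = R \o x.
Proof.
move=> bR aRT cR cT Mx; have bT := bounded_adjoint bR aRT.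
have [] : commutant [set y | y = R \/ y = T] x; last by move=> _; apply; left.
apply: Mx; split; last by move=> s Ss; split=> [|y [->|->]]; auto.
apply: commutant_von_neumann => [y [->|->] //|y [->|->]].
  by exists T => //; right.
by exists R; [left|apply: adjoint_sym].
Qed.

Lemma vn_generated_bounded x : vn_generated S x -> bounded_op x.
Proof.
(* The commutant of the identity consists of all bounded operators. *)
move=> Mx; have [] : commutant [set @idfun H] x => //.
apply: Mx; split; last by move=> s Ss; split=> [|y ->]; auto.
apply: commutant_von_neumann => [y ->|y ->]; first exact: bounded_id.
by exists idfun.
Qed.

End Generated.
End VonNeumann.

(** * The *-algebra Pol(O_F^+) *)

Section Star.
Context {C : numClosedFieldType} {A : starAlg C}.
Implicit Types (a b : A).

Lemma star0 : star (0 : A) = 0.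
Proof. by have := starZ 0 (0 : A); rewrite !scale0r rmorph0 scale0r. Qed.

Lemma star1 : star (1 : A) = 1.
Proof. by rewrite -[LHS]mulr1 -{2}[1]starK -starM mulr1 starK. Qed.

Lemma starN a : star (- a) = - star a.
Proof. by rewrite -scaleN1r starZ rmorphN1 scaleN1r. Qed.

Lemma starP k a b : star (k *: a + b) = k^* *: star a + star b.
Proof. by rewrite starD starZ. Qed.

Lemma star_sum (I : Type) (r : seq I) (P : pred I) (f : I -> A) :
  star (\sum_(i <- r | P i) f i) = \sum_(i <- r | P i) star (f i).
Proof. exact: (big_morph _ (@starD C A) star0). Qed.

End Star.

(** * The subalgebra generated by the entries of U *)

Section Subalgebra.
Context {C : numClosedFieldType} {n : nat} {A : starAlg C}.
Variable U : 'M[A]_n.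

(** There is no constructor for [star]: stability under it follows from the relations once F is
    invertible, see [generated_star_gen]. *)
Inductive generated : A -> Prop :=
| generated1 : generated 1
| generated_gen i j : generated (U i j)
| generated_lin k a b : generated a -> generated b -> generated (k *: a + b)
| generatedM a b : generated a -> generated b -> generated (a * b).

Definition generated_pred : {pred A} := fun a => `[< generated a >].

Lemma generated_closed : subalg_closed generated_pred.
Proof.
split=> [|k a b|a b]; rewrite /in_mem /=; first exact/asboolP/generated1.
  by move=> /asboolP ga /asboolP gb; apply/asboolP/generated_lin.
by move=> /asboolP ga /asboolP gb; apply/asboolP/generatedM.
Qed.

HB.instance Definition _ :=
  GRing.isSubalgClosed.Build C A generated_pred generated_closed.

Definition generated_type := {a | a \in generated_pred}.

HB.instance Definition _ := SubChoice.on generated_type.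
HB.instance Definition _ := [SubChoice_isSubAlgebra of generated_type by <:].

Lemma generated0 : generated 0.
Proof.
have g := generated_lin (-1) generated1 generated1.
by rewrite scaleN1r addNr in g.
Qed.

Lemma generated_sum (I : finType) (k : I -> C) (f : I -> A) :
  (forall i, generated (f i)) -> generated (\sum_i k i *: f i).
Proof.
move=> gf; elim/big_ind: _ => [|a b ga gb|i _]; first exact: generated0.
  by rewrite -[a]scale1r; apply: generated_lin.
by rewrite -[_ *: _]addr0; apply: generated_lin => //; apply: generated0.
Qed.

End Subalgebra.

Section GeneratedStar.
Context {C : numClosedFieldType} {n : nat} {A : starAlg C}.
Variable U : 'M[A]_n.
Hypothesis star_gen : forall i j, generated U (star (U i j)).

Lemma generated_star a : generated U a -> generated U (star a).
Proof.
elim=> [|i j|k x y _ gx _ gy|x y _ gx _ gy] //.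
- by rewrite star1; apply: generated1.
- by rewrite starP; apply: generated_lin.
- by rewrite starM; apply: generatedM.
Qed.

Let S_star (a : generated_type U) : generated_type U.
Proof.
exists (star (val a)); apply/asboolP/generated_star.
by apply/asboolP; exact: (valP a).
Defined.

Definition generated_starAlg : starAlg C.
Proof.
refine (@StarAlg C (generated_type U) S_star _ _ _ _).
- by move=> a b; apply: val_inj; rewrite /= starD.
- by move=> k a; apply: val_inj; rewrite /= starZ.
- by move=> a b; apply: val_inj; rewrite /= starM.
- by move=> a; apply: val_inj; rewrite /= starK.
Defined.

Definition generated_val (a : generated_starAlg) : A :=
  \val (a : generated_type U).

Lemma generated_val_linear : linear generated_val.
Proof. by []. Qed.

Lemma generated_val_monoid_morphism : monoid_morphism generated_val.
Proof. by []. Qed.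

HB.instance Definition _ :=
  GRing.isLinear.Build C generated_starAlg A *:%R generated_val
    generated_val_linear.
HB.instance Definition _ :=
  GRing.isMonoidMorphism.Build generated_starAlg A generated_val
    generated_val_monoid_morphism.

Definition generated_mx : 'M[generated_starAlg]_n :=
  \matrix_(i, j) exist _ (U i j) (asboolT (generated_gen U i j)).

End GeneratedStar.

Section Relations.
Context {C : numClosedFieldType} {n : nat}.
Variable F : 'M[C]_n.

Lemma mxbar_map (A B : starAlg C) (f : {lrmorphism A -> B}) (V : 'M[A]_n) :
  star_morphism f -> mxbar (map_mx f V) = map_mx f (mxbar V).
Proof. by move=> sf; apply/matrixP => i j; rewrite !mxE sf. Qed.

Lemma map_in_alg (A B : starAlg C) (f : {lrmorphism A -> B}) (G : 'M[C]_n) :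
  map_mx f (map_mx (in_alg A) G) = map_mx (in_alg B) G.
Proof. by apply/matrixP => i j; rewrite !mxE rmorph_alg. Qed.

Lemma orthogonal_relations_inj (A B : starAlg C) (f : {lrmorphism A -> B})
  (V : 'M[A]_n) : star_morphism f -> injective f ->
  orthogonal_relations F (map_mx f V) -> orthogonal_relations F V.
Proof.
move=> sf injf [r1 r2 r3].
have injm : injective (map_mx f : 'M[A]_n -> 'M[B]_n).
  move=> X Y /matrixP XY; apply/matrixP => i j; apply: injf.
  by have := XY i j; rewrite !mxE.
split; apply: injm.
- by rewrite map_mxM -map_trmx map_mx1 -mxbar_map.
- by rewrite map_mxM -map_trmx map_mx1 -mxbar_map.
- by rewrite !map_mxM !map_in_alg -mxbar_map.
Qed.

(** Two relations are quadratic and the third is homogeneous, so the sign disappears. By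
    universality this yields the parity automorphism. *)
Lemma orthogonal_relationsN (A : starAlg C) (V : 'M[A]_n) :
  orthogonal_relations F V -> orthogonal_relations F (- V).
Proof.
have vN : mxbar (- V) = - mxbar V.
  by apply/matrixP => i j; rewrite !mxE starN.
case=> r1 r2 r3.
rewrite /orthogonal_relations vN linearN /= !mulmxN !mulNmx !opprK.
by split=> //; rewrite -r3.
Qed.

Section Entries.
Variables (A : starAlg C) (U : 'M[A]_n).
Hypothesis relU : orthogonal_relations F U.
Hypothesis unitF : F \in unitmx.

Lemma rel_UUs i j : \sum_k U i k * star (U j k) = (i == j)%:R.
Proof.
case: relU => /matrixP /(_ i j) + _ _; rewrite !mxE => <-.
by apply: eq_bigr => k _; rewrite !mxE.
Qed.

Lemma rel_UsU i j : \sum_k star (U k i) * U k j = (i == j)%:R.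
Proof.
case: relU => _ /matrixP /(_ i j) + _; rewrite !mxE => <-.
by apply: eq_bigr => k _; rewrite !mxE.
Qed.

Lemma rel_UF i j : \sum_k F k j *: U i k = \sum_k F i k *: star (U k j).
Proof.
case: relU => _ _ r3.
have /matrixP/(_ i j) : U *m map_mx (in_alg A) F = map_mx (in_alg A) F *m mxbar U.
  rewrite [in LHS]r3 -!mulmxA -map_mxM mulVmx // map_mx1 mulmx1 //.
rewrite !mxE; under eq_bigr do rewrite !mxE mulr_algr.
by move=> ->; apply: eq_bigr => k _; rewrite !mxE mulr_algl.
Qed.

Lemma rel_FU i j :
  \sum_k (F k j)^* *: star (U i k) = \sum_k (F i k)^* *: U k j.
Proof.
have := congr1 (@star C A) (rel_UF i j); rewrite !star_sum.
under eq_bigr do rewrite starZ.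
by move=> ->; apply: eq_bigr => k _; rewrite starZ starK.
Qed.

(** This is the relation solved for the conjugate matrix, in the form F^-1 U F. *)
Lemma star_gen_expansion i j :
  star (U i j) = \sum_k \sum_l (invmx F i k * F l j) *: U k l.
Proof.
transitivity (\sum_k invmx F i k *: (\sum_l F l j *: U k l)); last first.
  apply: eq_bigr => k _; rewrite scaler_sumr.
  by apply: eq_bigr => l _; rewrite scalerA.
under eq_bigr do rewrite rel_UF scaler_sumr.
rewrite exchange_big /=; under eq_bigr do under eq_bigr do rewrite scalerA.
under eq_bigr do rewrite -scaler_suml.
rewrite (bigD1 i) //= [X in _ + X]big1 ?addr0 => [|k ki].
  have /matrixP/(_ i i) := mulVmx unitF; rewrite !mxE eqxx => ->.
  by rewrite scale1r.
have /matrixP/(_ i k) := mulVmx unitF; rewrite !mxE eq_sym (negPf ki) => ->.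
by rewrite scale0r.
Qed.

Lemma generated_star_gen i j : generated U (star (U i j)).
Proof.
rewrite star_gen_expansion pair_big /=.
apply: (@generated_sum _ _ _ _ _ (fun p => _ * _) (fun p => U p.1 p.2)) => p.
exact: generated_gen.
Qed.

End Entries.

Section Universal.
Variables (A : starAlg C) (U : 'M[A]_n).
Hypothesis polU : is_Pol_OF F U.
Hypothesis unitF : F \in unitmx.

(** The generated subalgebra satisfies the relations, so universality gives a map [f] into it.
    Followed by the inclusion [v], it is an endomorphism fixing [U], which is the identity by
    uniqueness. *)
Lemma Pol_generated a : generated U a.
Proof.
have [relU univ] := polU.
have sg := generated_star_gen relU unitF.
pose B := generated_starAlg sg.
pose v : {lrmorphism B -> A} := @generated_val _ _ _ _ sg.
have sv : star_morphism v by [].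
have vU : map_mx v (generated_mx sg) = U by apply/matrixP => i j; rewrite !mxE.
have relB : orthogonal_relations F (generated_mx sg).
  by apply: (orthogonal_relations_inj sv val_inj); rewrite vU.
have [f [sf fU _]] := univ _ _ relB.
have [g [_ _ uniq]] := univ _ _ relU.
pose vf : {lrmorphism A -> A} := v \o f.
have -> : a = v (f a).
  rewrite -[RHS]/(vf a) (uniq vf); last 2 first.
  - by move=> x; rewrite /= sf sv.
  - by rewrite map_mx_comp fU.
  apply: (uniq idfun) => //.
  by apply/matrixP => i j; rewrite !mxE.
by apply/asboolP; exact: (valP (f a)).
Qed.

Lemma Pol_ind (P : A -> Prop) : P 1 ->
  (forall k a b, P a -> P b -> P (k *: a + b)) ->
  (forall i j a, P a -> P (U i j * a)) -> forall a, P a.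
Proof.
move=> P1 Plin PU a; rewrite -[a]mulr1; move: (1 : A) P1.
elim: (Pol_generated a) => {a} [|i j|k a b _ IHa _ IHb|a b _ IHa _ IHb] x Px.
- by rewrite mul1r.
- exact: PU.
- by rewrite mulrDl -scalerAl; apply: Plin; auto.
- by rewrite -mulrA; auto.
Qed.

End Universal.
End Relations.

(** * The Haar state *)

Section Haar.
Context {C : numClosedFieldType} {n : nat}.
Variables (F : 'M[C]_n) (A AA : starAlg C) (U : 'M[A]_n).
Variables (t : {bilinear A -> A -> AA}) (Delta : {lrmorphism A -> AA}).
Variable h : {scalar A}.
Hypothesis unitF : F \in unitmx.
Hypothesis polU : is_Pol_OF F U.
Hypothesis tensor_t : is_tensor_product t.
Hypothesis comultD : is_comultiplication U t Delta.
Hypothesis haar_h : is_haar_state t Delta h.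

Let relU : orthogonal_relations F U := proj1 polU.

Lemma parity_ex : exists alpha : {lrmorphism A -> A},
  star_morphism alpha /\ forall i j, alpha (U i j) = - U i j.
Proof.
have [f [sf fU _]] := proj2 polU _ _ (orthogonal_relationsN relU).
exists f; split=> // i j; have /matrixP/(_ i j) := fU.
by rewrite !mxE.
Qed.

Lemma haar1 : h 1 = 1.
Proof. by case: haar_h. Qed.

Lemma haar_ge0 a : 0 <= h (star a * a).
Proof. by case: haar_h. Qed.

Section Slices.

(** The universal property of the tensor product turns this bilinear map into the slice map of [h]
    on the first leg. *)
Definition left_slice (a b : A) : A := h a *: b.

Lemma left_slice_bilinear : bilinear_for *:%R *:%R left_slice.
Proof.
split=> [b|a] k x y; rewrite /left_slice; last first.
  by rewrite scalerDr /= !scalerA mulrC.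
by rewrite linearP scalerDl /= -scalerA.
Qed.

HB.instance Definition _ := bilinear_isBilinear.Build C A A A *:%R *:%R
  left_slice left_slice_bilinear.

Definition right_slice (a b : A) : A := h b *: a.

Lemma right_slice_bilinear : bilinear_for *:%R *:%R right_slice.
Proof.
split=> [b|a] k x y; rewrite /right_slice.
  by rewrite scalerDr /= !scalerA mulrC.
by rewrite linearP scalerDl /= -scalerA.
Qed.

HB.instance Definition _ := bilinear_isBilinear.Build C A A A *:%R *:%R
  right_slice right_slice_bilinear.

Lemma haar_left a (s : seq (A * A)) : Delta a = \sum_(p <- s) t p.1 p.2 ->
  \sum_(p <- s) h p.1 *: p.2 = h a *: 1.
Proof.
move=> Da; have [_ _ _ univ] := tensor_t; have [_ _ inv _] := haar_h.
have [L [Lt _]] := univ A left_slice.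
by rewrite -(inv L) // Da linear_sum; apply: eq_bigr => p _; rewrite Lt.
Qed.

Lemma haar_right a (s : seq (A * A)) : Delta a = \sum_(p <- s) t p.1 p.2 ->
  \sum_(p <- s) h p.2 *: p.1 = h a *: 1.
Proof.
move=> Da; have [_ _ _ univ] := tensor_t; have [_ _ _ inv] := haar_h.
have [L [Lt _]] := univ A right_slice.
by rewrite -(inv L) // Da linear_sum; apply: eq_bigr => p _; rewrite Lt.
Qed.

End Slices.

(** * The parity automorphism preserves the Haar state *)

Section Parity.
Variable alpha : {lrmorphism A -> A}.
Hypothesis alphaU : forall i j, alpha (U i j) = - U i j.

Lemma parityK a : alpha (alpha a) = a.
Proof.
move: a; apply: (Pol_ind polU unitF) => [|k a b aK bK|i j a aK].
- by rewrite !rmorph1.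
- by rewrite linearP /= linearP /= aK bK.
- rewrite rmorphM /= alphaU mulNr rmorphN rmorphM /= alphaU mulNr opprK.
  by rewrite aK.
Qed.

(** The intertwining of [Delta] and [alpha] on the second leg, expressed through one list of
    elementary tensors that serves for both [a] and [alpha a]. *)
Lemma comultiplication_parity a : exists s : seq (A * A),
  Delta a = \sum_(p <- s) t p.1 p.2 /\
  Delta (alpha a) = \sum_(p <- s) t p.1 (alpha p.2).
Proof.
have [t11 tM _ _] := tensor_t; have [_ DU] := comultD.
move: a; apply: (Pol_ind polU unitF) =>
  [|k a b [s [Da Daa]] [r [Db Dab]]|i j a [s [Da Daa]]].
- by exists [:: (1, 1)]; rewrite !big_seq1 !rmorph1 t11.
- exists ([seq (k *: p.1, p.2) | p <- s] ++ r).
  rewrite !big_cat !big_map 3!linearP /= Da Daa Db Dab !scaler_sumr.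
  by split; congr (_ + _); apply: eq_bigr => p _; rewrite linearZl_LR.
exists [seq (U i k * p.1, U k j * p.2) | k <- enum 'I_n, p <- s].
rewrite !big_allpairs_dep /= !big_enum /=.
split.
  rewrite rmorphM /= DU Da mulr_suml; apply: eq_bigr => k _.
  by rewrite mulr_sumr; apply: eq_bigr => p _; rewrite tM.
rewrite rmorphM /= alphaU mulNr rmorphN rmorphM /= DU Daa mulr_suml -sumrN.
apply: eq_bigr => k _; rewrite mulr_sumr -sumrN; apply: eq_bigr => p _.
by rewrite tM rmorphM /= alphaU mulNr linearNr.
Qed.

(** Slicing the first leg of [Delta (alpha a)] with [h] gives [alpha] of the slice of [Delta a],
    that is [alpha (h a *: 1) = h a *: 1]; invariance also gives [h (alpha a) *: 1]. *)
Lemma haar_parity a : h (alpha a) = h a.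
Proof.
have [s [Da Daa]] := comultiplication_parity a.
have Daa' : Delta (alpha a) =
    \sum_(p <- [seq (p.1, alpha p.2) | p <- s]) t p.1 p.2 by rewrite big_map.
have := congr1 h (haar_left Daa'); rewrite big_map /=.
under eq_bigr do rewrite -linearZ.
rewrite -linear_sum (haar_left Da) !linearZ /= rmorph1 haar1.
by rewrite !mulr1.
Qed.

End Parity.

Lemma comultiplication_sum a : exists s : seq (A * A),
  Delta a = \sum_(p <- s) t p.1 p.2.
Proof.
have [alpha [_ aU]] := parity_ex.
by have [s [Ds _]] := comultiplication_parity aU a; exists s.
Qed.

Lemma mul_sum_scale (I J : finType) (x : I -> C) (a : I -> A) (y : J -> C)
    (b : J -> A) :
  (\sum_i x i *: a i) * (\sum_j y j *: b j) =
  \sum_i \sum_j (x i * y j) *: (a i * b j).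
Proof.
rewrite mulr_suml; apply: eq_bigr => i _; rewrite mulr_sumr.
by apply: eq_bigr => j _; rewrite -scalerAl -scalerAr scalerA.
Qed.

(** * The twisted functional and the modular property of the Haar state *)

Definition gram : 'M[C]_n := (map_mx conjC F)^T *m F.

Lemma gramE r s : gram r s = \sum_p (F p r)^* * F p s.
Proof. by rewrite mxE; apply: eq_bigr => p _; rewrite !mxE. Qed.

Lemma gram_unit : gram \in unitmx.
Proof. by rewrite unitmx_mul unitmx_tr map_unitmx unitF. Qed.

(* In matrix form, U^T W \bar U = W for W = F^* F. *)
Lemma gram_invariant j l :
  \sum_r \sum_s gram r s *: (U r j * star (U s l)) = gram j l *: 1.
Proof.
(* Factoring W through F lets the third relation act on each factor; the sum over [p] is then an
   entry of U^* U. *)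
transitivity (\sum_p (\sum_r (F p r)^* *: U r j) *
                     (\sum_s F p s *: star (U s l))).
  under [RHS]eq_bigr do rewrite mul_sum_scale.
  rewrite [RHS]exchange_big; apply: eq_bigr => r _.
  rewrite [RHS]exchange_big; apply: eq_bigr => s _.
  by rewrite gramE scaler_suml.
under eq_bigr do rewrite -(rel_FU relU unitF) -(rel_UF relU unitF) mul_sum_scale.
rewrite exchange_big gramE scaler_suml; apply: eq_bigr => k _ /=.
rewrite exchange_big /= (bigD1 k) //= [X in _ + X]big1 ?addr0 => [|m mk].
  by rewrite -scaler_sumr (rel_UsU relU) eqxx.
by rewrite -scaler_sumr (rel_UsU relU) eq_sym (negPf mk) scaler0.
Qed.

Lemma comultiplication_sandwich i j k l a (s : seq (A * A)) :
  Delta a = \sum_(p <- s) t p.1 p.2 ->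
  Delta (star (U i j) * a * U k l) =
  \sum_x \sum_y \sum_(p <- s)
    t (star (U i x) * p.1 * U k y) (star (U x j) * p.2 * U y l).
Proof.
have [_ tM tS _] := tensor_t; have [sD DU] := comultD.
move=> Da; rewrite rmorphM /= rmorphM /= sD !DU Da star_sum !mulr_suml.
apply: eq_bigr => x _; rewrite mulr_sumr; apply: eq_bigr => y _.
rewrite mulr_sumr mulr_suml; apply: eq_bigr => p _.
by rewrite tS !tM.
Qed.

(** Left invariance at u_ij^* a u_kl is multiplied by u_rj on the left and u_ql^* on the right.
    Summing over [j] and [l], the relation U U^* = 1 leaves only the terms with [x = r] and
    [y = q]. *)
Lemma haar_sandwich i k r q a (s : seq (A * A)) :
  Delta a = \sum_(p <- s) t p.1 p.2 ->
  \sum_(p <- s) h (star (U i r) * p.1 * U k q) *: p.2 =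
  \sum_j \sum_l h (star (U i j) * a * U k l) *: (U r j * star (U q l)).
Proof.
move=> Da; pose f x y (p : A * A) := h (star (U i x) * p.1 * U k y).
have slice j l : h (star (U i j) * a * U k l) *: 1 =
    \sum_x \sum_y \sum_(p <- s) f x y p *: (star (U x j) * p.2 * U y l).
  pose S := [seq ((star (U i z.1) * p.1 * U k z.2),
    (star (U z.1 j) * p.2 * U z.2 l)) |
    z <- index_enum ('I_n * 'I_n)%type, p <- s].
  rewrite -(@haar_left _ S); last first.
    rewrite (comultiplication_sandwich _ _ _ _ Da) pair_big /=.
    by rewrite big_allpairs_dep.
  by rewrite big_allpairs_dep pair_big.
transitivity (\sum_j \sum_l
    U r j * (h (star (U i j) * a * U k l) *: 1) * star (U q l)); last first.
  apply: eq_bigr => j _; apply: eq_bigr => l _.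
  by rewrite -scalerAr mulr1 -scalerAl.
transitivity (\sum_x \sum_y \sum_(p <- s) f x y p *:
   ((\sum_j U r j * star (U x j)) * p.2 * (\sum_l U y l * star (U q l)))).
  rewrite (bigD1 r) //= [X in _ + X]big1 ?addr0 => [|x xr]; last first.
    rewrite big1 // => y _; rewrite big1 // => p _.
    by rewrite (rel_UUs relU) eq_sym (negPf xr) !mul0r scaler0.
  rewrite (bigD1 q) //= [X in _ + X]big1 ?addr0 => [|y yq]; last first.
    rewrite big1 // => p _.
    by rewrite [X in _ * X](rel_UUs relU) (negPf yq) mulr0 scaler0.
  by apply: eq_bigr => p _; rewrite !(rel_UUs relU) !eqxx mul1r mulr1.
under [RHS]eq_bigr do under eq_bigr do rewrite slice mulr_sumr mulr_suml.
under [RHS]eq_bigr do rewrite exchange_big.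
rewrite [RHS]exchange_big; apply: eq_bigr => x _ /=.
under [RHS]eq_bigr do under eq_bigr do rewrite mulr_sumr mulr_suml.
under [RHS]eq_bigr do rewrite exchange_big.
rewrite [RHS]exchange_big; apply: eq_bigr => y _ /=.
under [RHS]eq_bigr do under eq_bigr do rewrite mulr_sumr mulr_suml.
under [RHS]eq_bigr do rewrite exchange_big.
rewrite [RHS]exchange_big; apply: eq_bigr => p _ /=.
rewrite !mulr_suml scaler_sumr; apply: eq_bigr => j _.
rewrite mulr_sumr scaler_sumr; apply: eq_bigr => l _.
by rewrite -scalerAr -scalerAl !mulrA.
Qed.

Definition twisted_haar i k (a : A) : C :=
  \sum_r \sum_s gram r s * h (star (U i r) * a * U k s).

Lemma twisted_haar_scalar i k : scalar (twisted_haar i k).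
Proof.
move=> c a b; rewrite /twisted_haar mulr_sumr -big_split; apply: eq_bigr => r _.
rewrite mulr_sumr -big_split; apply: eq_bigr => s _ /=.
rewrite mulrDr mulrDl -scalerAr -scalerAl linearP mulrDr /=.
by rewrite mulrCA.
Qed.

HB.instance Definition _ i k := GRing.isLinear.Build C A C *%R
  (twisted_haar i k) (twisted_haar_scalar i k).

(** Write g for the functional. [haar_sandwich] and [gram_invariant] show that slicing the first leg
    of [Delta a] with g gives g(a) 1. Evaluating both g and [h] on the two legs of [Delta a] then
    gives g(a), and by right invariance of [h] it also gives g(1) h(a). *)
Lemma twisted_haarE i k a : twisted_haar i k a = twisted_haar i k 1 * h a.
Proof.
have [s Da] := comultiplication_sum a.
have slice : \sum_(p <- s) twisted_haar i k p.1 *: p.2 = twisted_haar i k a *: 1.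
  rewrite /twisted_haar scaler_suml.
  transitivity (\sum_r \sum_q gram r q *:
     \sum_(p <- s) h (star (U i r) * p.1 * U k q) *: p.2).
    under eq_bigr do rewrite scaler_suml.
    rewrite exchange_big; apply: eq_bigr => r _ /=.
    under eq_bigr do rewrite scaler_suml.
    rewrite exchange_big; apply: eq_bigr => q _ /=.
    by rewrite scaler_sumr; apply: eq_bigr => p _; rewrite scalerA.
  under eq_bigr do under eq_bigr do
    rewrite (haar_sandwich _ _ _ _ Da) scaler_sumr.
  under eq_bigr do rewrite exchange_big.
  rewrite exchange_big; apply: eq_bigr => j _ /=.
  under eq_bigr do under eq_bigr do rewrite scaler_sumr.
  under eq_bigr do rewrite exchange_big.
  rewrite exchange_big scaler_suml; apply: eq_bigr => l _ /=.
  rewrite mulrC -scalerA -gram_invariant scaler_sumr.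
  apply: eq_bigr => r _; rewrite scaler_sumr; apply: eq_bigr => q _.
  by rewrite !scalerA mulrC.
have := congr1 h slice; rewrite linear_sum linearZ /= haar1 mulr1 => <-.
have := congr1 (twisted_haar i k) (haar_right Da).
rewrite linear_sum linearZ /= mulrC => <-.
by apply: eq_bigr => p _; rewrite !linearZ /= mulrC.
Qed.

(** The functional is evaluated at a u_kq^* and summed over [k]. By its definition and U^* U = 1
    this is the left side; by [twisted_haarE] it is the right side. *)
Lemma haar_modular_gen i q a :
  h ((\sum_r gram r q *: star (U i r)) * a) =
  h (a * \sum_k twisted_haar i k 1 *: star (U k q)).
Proof.
transitivity (\sum_k twisted_haar i k (a * star (U k q))); last first.
  rewrite mulr_sumr linear_sum; apply: eq_bigr => k _.
  by rewrite twisted_haarE -scalerAr linearZ.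
rewrite /twisted_haar exchange_big mulr_suml linear_sum.
apply: eq_bigr => r _; rewrite exchange_big /= (bigD1 q) //=.
rewrite [X in _ + X]big1 ?addr0 => [|s sq]; rewrite -mulr_sumr -linear_sum /=.
  under [in RHS]eq_bigr do rewrite -!mulrA.
  by rewrite -!mulr_sumr (rel_UsU relU) eqxx mulr1 -scalerAl linearZ.
under eq_bigr do rewrite -!mulrA.
by rewrite -!mulr_sumr (rel_UsU relU) eq_sym (negPf sq) !mulr0 linear0 mulr0.
Qed.

(** The element [b'] plays the role of the image of [b] under the modular automorphism of [h]. *)
Definition modular (b : A) := exists b', forall a, h (b * a) = h (a * b').

Lemma modular_lin k b c : modular b -> modular c -> modular (k *: b + c).
Proof.
move=> [b' Eb] [c' Ec]; exists (k *: b' + c') => a.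
by rewrite mulrDl mulrDr -scalerAl -scalerAr !linearP /= Eb Ec.
Qed.

Lemma modular0 : modular 0.
Proof. by exists 0 => a; rewrite mul0r mulr0. Qed.

Lemma modular_sum (I : finType) (k : I -> C) (f : I -> A) :
  (forall i, modular (f i)) -> modular (\sum_i k i *: f i).
Proof.
move=> mf; elim/big_ind: _ => [|a b ma mb|i _]; first exact: modular0.
  by rewrite -[a]scale1r; apply: modular_lin.
by rewrite -[_ *: _]addr0; apply: modular_lin => //; apply: modular0.
Qed.

Lemma modularM b c : modular b -> modular c -> modular (b * c).
Proof.
move=> [b' Eb] [c' Ec]; exists (b' * c') => a.
by rewrite -mulrA Eb -mulrA Ec mulrA.
Qed.

Lemma modular_star_gen i m : modular (star (U i m)).
Proof.
(* Inverting [gram] recovers single entries from the combinations treated in [haar_modular_gen]. *)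
have -> : star (U i m) = \sum_q invmx gram q m *:
    \sum_r gram r q *: star (U i r).
  under eq_bigr do rewrite scaler_sumr.
  rewrite exchange_big (bigD1 m) //= [X in _ + X]big1 ?addr0 => [|r rm].
    under eq_bigr do rewrite scalerA mulrC; rewrite -scaler_suml.
    have /matrixP/(_ m m) := mulmxV gram_unit; rewrite !mxE eqxx => ->.
    by rewrite scale1r.
  under eq_bigr do rewrite scalerA mulrC; rewrite -scaler_suml.
  have /matrixP/(_ r m) := mulmxV gram_unit; rewrite !mxE (negPf rm) => ->.
  by rewrite scale0r.
apply: modular_sum => q; exists (\sum_k twisted_haar i k 1 *: star (U k q)) => a.
exact: haar_modular_gen.
Qed.

Lemma haar_modular b : modular b.
Proof.
move: b; apply: (Pol_ind polU unitF) => [|k b c|i j b mb].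
- by exists 1 => a; rewrite mul1r mulr1.
- exact: modular_lin.
(* The adjoint of [star_gen_expansion] writes [U i j] as a combination of adjoints of generators,
   for which [modular] is known. *)
apply: modularM => //; rewrite -(starK (U i j)).
rewrite (star_gen_expansion relU unitF) star_sum.
under eq_bigr do rewrite star_sum; rewrite pair_big /=.
under eq_bigr do rewrite starZ.
apply: (@modular_sum _ (fun p : 'I_n * 'I_n => (invmx F i p.1 * F p.2 j)^*)
  (fun p => star (U p.1 p.2))) => p.
exact: modular_star_gen.
Qed.

End Haar.

(** * The GNS representation *)

Lemma half_double (C : numClosedFieldType) (V : lmodType C) (v : V) :
  2^-1 *: (v + v) = v.
Proof.
by rewrite -mulr2n -(scaler_nat 2 v) scalerA mulVf ?pnatr_eq0 // scale1r.
Qed.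

Section GNS.
Context {C : numClosedFieldType} {n : nat}.
Variables (F : 'M[C]_n) (A AA : starAlg C) (U : 'M[A]_n).
Variables (t : {bilinear A -> A -> AA}) (Delta : {lrmorphism A -> AA}).
Variable h : {scalar A}.
Variables (H : hilbert C) (pi : A -> (H -> H)) (Omega : H).
Hypothesis unitF : F \in unitmx.
Hypothesis polU : is_Pol_OF F U.
Hypothesis tensor_t : is_tensor_product t.
Hypothesis comultD : is_comultiplication U t Delta.
Hypothesis haar_h : is_haar_state t Delta h.
Hypothesis gns : is_gns_star h pi Omega.

Let relU : orthogonal_relations F U := proj1 polU.

Let pi_bounded a : bounded_op (pi a).
Proof. by case: gns => -[]. Qed.

Let pi_lin k a b : pi (k *: a + b) = k *: pi a + pi b.
Proof. by case: gns => -[]. Qed.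

Let pi1 : pi 1 = id.
Proof. by case: gns => _ []. Qed.

Let piM a b : pi (a * b) = pi a \o pi b.
Proof. by case: gns => _ []. Qed.

Let pi_adjoint a : adjoint (pi a) (pi (star a)).
Proof. by case: gns. Qed.

Let pi_dense : dense (range (fun a => pi a Omega)).
Proof. by case: gns. Qed.

Let pi0 : pi 0 = fun=> 0.
Proof.
have := pi_lin (-1) 0 0; rewrite scaler0 addr0 => ->.
by apply/funext => xi; rewrite !fctE scaleN1r addNr.
Qed.

Let piN a : pi (- a) = - pi a.
Proof.
have := pi_lin (-1) a 0; rewrite addr0 scaleN1r => ->.
by apply/funext => xi; rewrite pi0 !fctE addr0 scaleN1r.
Qed.

Let pi_sum (I : Type) (r : seq I) (f : I -> A) :
  pi (\sum_(i <- r) f i) = \sum_(i <- r) pi (f i).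
Proof.
apply: (big_morph pi) => [a b|]; last exact: pi0.
by have := pi_lin 1 a b; rewrite !scale1r.
Qed.

Let orbit_lin k a b : pi (k *: a + b) Omega = k *: pi a Omega + pi b Omega.
Proof. by rewrite pi_lin. Qed.

Lemma gns_inner a b : inner (pi a Omega) (pi b Omega) = h (star b * a).
Proof.
case: gns => _ _ _ <- _; rewrite piM /=.
by rewrite -[in LHS](starK b) -pi_adjoint.
Qed.

Lemma gns_norm a : `|pi a Omega| ^+ 2 = h (star a * a).
Proof. by rewrite norm_innerE gns_inner. Qed.

Lemma haar_star a : h (star a) = (h a)^*.
Proof.
rewrite -[star a]mulr1 -gns_inner innerC gns_inner star1.
by rewrite mul1r.
Qed.

(** Right multiplication by [b] is bounded on the dense subspace of GNS vectors. As [h] need not be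
    tracial, this is not immediate. *)
Definition right_bounded b := exists2 k, 0 <= k &
  forall a, `|pi (a * b) Omega| <= k * `|pi a Omega|.

Lemma right_bounded_lin k b c : right_bounded b -> right_bounded c ->
  right_bounded (k *: b + c).
Proof.
move=> [kb b0 Hb] [kc c0 Hc]; exists (`|k| * kb + kc) => [|a].
  by rewrite addr_ge0 ?mulr_ge0.
rewrite mulrDr -scalerAr orbit_lin mulrDl.
apply: le_trans (ler_normD _ _) _; apply: lerD => //.
by rewrite normrZ -mulrA ler_wpM2l.
Qed.

Lemma right_bounded0 : right_bounded 0.
Proof. by exists 0 => // a; rewrite mulr0 pi0 normr0 mul0r. Qed.

Lemma right_bounded_sum (I : finType) (k : I -> C) (f : I -> A) :
  (forall i, right_bounded (f i)) -> right_bounded (\sum_i k i *: f i).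
Proof.
move=> mf; elim/big_ind: _ => [|a b ma mb|i _]; first exact: right_bounded0.
  by rewrite -[a]scale1r; apply: right_bounded_lin.
rewrite -[_ *: _]addr0; apply: right_bounded_lin => //.
exact: right_bounded0.
Qed.

Lemma right_boundedM b c : right_bounded b -> right_bounded c ->
  right_bounded (b * c).
Proof.
move=> [kb b0 Hb] [kc c0 Hc]; exists (kc * kb) => [|a]; first exact: mulr_ge0.
rewrite mulrA -[kc * kb * _]mulrA; apply: le_trans (Hc _) _.
by rewrite ler_wpM2l.
Qed.

(* The terms of twisted_haar i i (a^* a) are the squared norms of the a v_ip;
   each is bounded by the sum, a multiple of h (a^* a). *)
Lemma right_bounded_twist i p : right_bounded (\sum_s F p s *: U i s).
Proof.
pose v p := \sum_s F p s *: U i s; pose g := twisted_haar F U h i i.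
have gE a : \sum_p h (star (v p) * a * v p) = g a.
  rewrite /g /twisted_haar.
  transitivity (\sum_p \sum_r \sum_s
      ((F p r)^* * F p s) * h (star (U i r) * a * U i s)).
    apply: eq_bigr => q _; rewrite /v star_sum.
    under eq_bigr do rewrite starZ.
    rewrite mulr_suml mulr_suml linear_sum; apply: eq_bigr => r _.
    rewrite mulr_sumr linear_sum; apply: eq_bigr => s _ /=.
    by rewrite -!scalerAl -scalerAr !linearZ /= -mulrA mulrCA.
  rewrite exchange_big; apply: eq_bigr => r _ /=.
  rewrite exchange_big; apply: eq_bigr => s _ /=.
  by rewrite gramE mulr_suml.
have pos q a : 0 <= h (star (v q) * (star a * a) * v q).
  by rewrite !mulrA -mulrA -starM; apply: (haar_ge0 haar_h).
have g0 : 0 <= g 1.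
  by rewrite -gE sumr_ge0 // => q _; rewrite -[1](mulr1 1) -{1}star1.
(* By [twisted_haarE], g(a^* a) is [g 1] times the squared norm of [pi a Omega]. *)
exists (sqrtC (g 1)) => [|a]; first by rewrite sqrtC_ge0.
rewrite -ler_sqr ?nnegrE ?mulr_ge0 ?sqrtC_ge0 //.
rewrite exprMn sqrtCK !gns_norm.
rewrite -(twisted_haarE unitF polU tensor_t comultD haar_h) -/g -gE.
have -> : star (a * v p) * (a * v p) = star (v p) * (star a * a) * v p.
  by rewrite starM !mulrA.
by rewrite (bigD1 p) //= lerDl sumr_ge0.
Qed.

Lemma haar_right_bounded b : right_bounded b.
Proof.
move: b; apply: (Pol_ind polU unitF) => [|k b c|i j b rb].
- by exists 1 => // a; rewrite mulr1 mul1r.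
- exact: right_bounded_lin.
apply: right_boundedM => //.
(* Inverting F recovers the generators from the elements of [right_bounded_twist]. *)
have -> : U i j = \sum_p invmx F j p *: \sum_s F p s *: U i s.
  under eq_bigr do rewrite scaler_sumr.
  rewrite exchange_big (bigD1 j) //= [X in _ + X]big1 ?addr0 => [|s sj].
    under eq_bigr do rewrite scalerA; rewrite -scaler_suml.
    have /matrixP/(_ j j) := mulVmx unitF; rewrite !mxE eqxx => ->.
    by rewrite scale1r.
  under eq_bigr do rewrite scalerA; rewrite -scaler_suml.
  have /matrixP/(_ j s) := mulVmx unitF; rewrite !mxE eq_sym (negPf sj) => ->.
  by rewrite scale0r.
by apply: right_bounded_sum => p; apply: right_bounded_twist.
Qed.

Lemma right_mul_op b : exists R T : H -> H,
  [/\ bounded_op R, adjoint R T & forall a,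
    R (pi a Omega) = pi (a * b) Omega /\
    R \o pi a = pi a \o R /\ T \o pi a = pi a \o T].
Proof.
have ext c : exists2 R, bounded_op R &
    forall a, R (pi a Omega) = pi (a * c) Omega.
  have [k k0 kR] := haar_right_bounded c.
  apply: (extend_bounded_op (k := k)) => // l x y.
  by rewrite mulrDl -scalerAl.
(* The adjoint of right multiplication by [b] is right multiplication by [b']: after conjugation,
   adjointness on GNS vectors reads h(b^* x^* y) = h(x^* y b'). *)
have [b' Eb] := haar_modular unitF polU tensor_t comultD haar_h (star b).
have [R bR Rpi] := ext b; have [T bT Tpi] := ext b'.
have comm S c a : bounded_op S -> (forall a, S (pi a Omega) = pi (a * c) Omega) ->
    S \o pi a = pi a \o S.
  move=> bS Spi; apply: (eq_op_dense pi_dense); try exact: bounded_comp.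
  move=> _ [x _ <-] /=.
  have piE u v : pi u (pi v Omega) = pi (u * v) Omega by rewrite piM.
  by rewrite piE !Spi piE mulrA.
exists R, T; split=> // [|a]; last first.
  by rewrite Rpi !(comm _ _ _ bR Rpi) !(comm _ _ _ bT Tpi).
apply: (adjoint_dense pi_dense) => // _ _ [x _ <-] [y _ <-].
rewrite Rpi Tpi !gns_inner starM.
apply: (can_inj (@conjCK C)); rewrite -!haar_star !starM !starK.
by rewrite -mulrA Eb mulrA.
Qed.

Lemma gens_bounded : range pi `<=` bounded_op.
Proof. by move=> _ [a _ <-]. Qed.

(** With [R] the right multiplication by [b], which commutes with [x], one has x (pi b Omega) = x R
    Omega = R x Omega = 0, and such vectors are dense. *)
Lemma Omega_separating x : Linfty pi x -> x Omega = 0 -> x = 0.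
Proof.
move=> Mx x0; have bx := vn_generated_bounded gens_bounded Mx.
apply: (eq_op_dense pi_dense) => //.
  split=> [k xi eta|]; first by rewrite scaler0 addr0.
  by exists 0 => xi; rewrite normr0 mul0r.
move=> _ [b _ <-].
have [R [T [bR aRT RT]]] := right_mul_op b.
have RO : R Omega = pi b Omega by have [+ _] := RT 1; rewrite pi1 mul1r.
have xR : x \o R = R \o x.
  by apply: (vn_generated_commute gens_bounded bR aRT) Mx => _ [a _ <-];
    have [_ []] := RT a.
by rewrite -RO -[x (R _)]/((x \o R) Omega) xR /= x0 (op0 bR).
Qed.

(** * The vector state of Omega and its GNS space *)

Lemma series_single (V : normedModType C) (u : nat -> V) :
  (forall k, (0 < k)%N -> u k = 0) -> series u @ \oo --> u 0%N.
Proof.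
move=> u0; apply: cvg_near_cst; exists 1%N => // k /= k0.
rewrite /series /= big_ltn // big_nat big1 ?addr0 // => i /andP[i0 _].
exact: u0.
Qed.

Lemma vector_state_normal : sigma_weak_functional (vector_state Omega).
Proof.
(* A vector state is the one-term case of a sigma-weak functional. *)
pose xi k : H := if k == 0%N then Omega else 0.
have cvx : cvgn (series (fun k => `|xi k| ^+ 2)).
  apply/cvg_ex; exists (`|xi 0%N| ^+ 2); apply: series_single => -[|k] // _.
  by rewrite normr0 expr0n.
exists xi, xi; split=> // T bT.
apply: (@series_single _ (fun k => inner (T (xi k)) (xi k))) => -[|k] // _.
by rewrite inner0r.
Qed.

Lemma vector_state_faithful :
  faithful_normal_positive_functional (Linfty pi) (vector_state Omega).
Proof.
split.
- by move=> k x y _ _; rewrite /vector_state !fctE innerDl innerZl.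
- by move=> x _; apply.
- move=> x Mx px x0; apply: Omega_separating => //.
  by apply: positive_op_eq0 => //; apply: (vn_generated_bounded gens_bounded).
- by exists (vector_state Omega) => //; apply: vector_state_normal.
Qed.

(** The space [H], on which the algebra already acts, serves as its L^2-space. *)
Lemma gns_Linfty : is_gns_vn (Linfty pi) (vector_state Omega) id Omega.
Proof.
split=> //.
  by split=> // x; apply: (vn_generated_bounded gens_bounded).
move=> O O0 oO; have [y [Oy [a _ ay]]] := pi_dense O0 oO.
exists y; split=> //; exists (pi a) => //.
by apply: vn_generated_gen; exists a.
Qed.

(** * The parity operator and the even subalgebra *)

Section Parity.
Variable alpha : {lrmorphism A -> A}.
Hypothesis star_alpha : star_morphism alpha.
Hypothesis alphaU : forall i j, alpha (U i j) = - U i j.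

Let alphaK a : alpha (alpha a) = a.
Proof. exact: (parityK unitF polU alphaU). Qed.

Let haar_alpha a : h (alpha a) = h a.
Proof. exact: (haar_parity unitF polU tensor_t comultD haar_h alphaU). Qed.

(** Since [alpha] is a *-morphism preserving [h], it is isometric on GNS vectors and extends to [H];
    self-adjointness follows from [alpha] being an involution. *)
Lemma parity_op : exists V : H -> H,
  [/\ bounded_op V, adjoint V V, V \o V = id, V Omega = Omega &
      forall a, V (pi a Omega) = pi (alpha a) Omega /\
                V \o pi a = pi (alpha a) \o V].
Proof.
have linV k a b : pi (alpha (k *: a + b)) Omega =
    k *: pi (alpha a) Omega + pi (alpha b) Omega by rewrite linearP orbit_lin.
have isoV a : `|pi (alpha a) Omega| <= 1 * `|pi a Omega|.
  rewrite mul1r -ler_sqr ?nnegrE // !gns_norm -star_alpha.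
  by rewrite -rmorphM haar_alpha.
have [V bV Vpi] := extend_bounded_op orbit_lin linV pi_dense isoV.
have piE u v : pi u (pi v Omega) = pi (u * v) Omega by rewrite piM.
exists V; split=> //.
- apply: (adjoint_dense pi_dense) => // _ _ [x _ <-] [y _ <-].
  rewrite !Vpi !gns_inner -(haar_alpha (star y * _)) rmorphM /= alphaK.
  by rewrite star_alpha.
- apply: (eq_op_dense pi_dense); [exact: bounded_comp|exact: bounded_id|].
  by move=> _ [x _ <-]; rewrite /= !Vpi alphaK.
- by have := Vpi 1; rewrite rmorph1 pi1.
- move=> a; split=> //; apply: (eq_op_dense pi_dense); try exact: bounded_comp.
  by move=> _ [x _ <-] /=; rewrite piE !Vpi piE rmorphM.
Qed.

Let even_gens_bounded :
  [set x | exists i j k l, x = pi (U i j * U k l)] `<=` bounded_op.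
Proof. by move=> _ [i [j [k [l ->]]]]. Qed.

Lemma even_Linfty_pi a : alpha a = a -> even_Linfty U pi (pi a).
Proof.
pose N := even_Linfty U pi.
have N1 : N (pi 1) by rewrite pi1; apply: vn_generated_id.
have Nlin k x y : N (pi x) -> N (pi y) -> N (pi (k *: x + y)).
  by rewrite pi_lin; apply: vn_generated_lin.
have N0 : N (pi 0).
  by have := Nlin (-1) _ _ N1 N1; rewrite scaleN1r addNr.
have NU i j k l : N (pi (U i j * U k l)).
  by apply: vn_generated_gen; exists i, j, k, l.
(* The even part and the odd part are followed together, because left multiplication by a generator
   exchanges them. The odd part is multiplied by a generator to bring it into [N]. *)
have main : forall a, N (pi (a + alpha a)) /\
    forall k l, N (pi (U k l * (a - alpha a))).
  apply: (Pol_ind polU unitF) => [|k x y [xe xo] [ye yo]|i j x [xe xo]].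
  - rewrite rmorph1 subrr; split; first by rewrite -{1}[1]scale1r; apply: Nlin.
    by move=> k l; rewrite mulr0.
  - rewrite linearP /=; split=> [|i j].
      by rewrite addrACA -scalerDr; apply: Nlin.
    rewrite opprD addrACA -scalerBr mulrDr -scalerAr.
    exact: Nlin.
  - rewrite rmorphM /= alphaU mulNr; split=> [|k l]; first by rewrite -mulrBr.
    rewrite opprK -mulrDr mulrA piM.
    by apply: vn_generated_comp; [exact: NU|exact: xe].
move=> ae; have [+ _] := main a; rewrite ae => Na.
by have := Nlin 2^-1 _ _ Na N0; rewrite addr0 half_double.
Qed.

Lemma even_Linfty_sub x : even_Linfty U pi x -> Linfty pi x.
Proof.
move=> Nx M [vM piM']; apply: Nx; split=> // _ [i [j [k [l ->]]]].
by apply: piM'; exists (U i j * U k l).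
Qed.

Section Expectation.
Variable V : H -> H.
Hypothesis bV : bounded_op V.
Hypothesis aV : adjoint V V.
Hypothesis VV : V \o V = id.
Hypothesis VOmega : V Omega = Omega.
Hypothesis Vpi : forall a, V (pi a Omega) = pi (alpha a) Omega.
Hypothesis Vcomm : forall a, V \o pi a = pi (alpha a) \o V.

(** This is (1 + V) / 2, written so that [bounded_lin] applies twice. *)
Definition even_projection : H -> H := 2^-1 *: ((-1) *: idfun + V) + idfun.

Lemma even_projectionE xi : even_projection xi = 2^-1 *: (V xi + xi).
Proof.
rewrite /even_projection !fctE /= scaleN1r -[X in _ + X = _]half_double -scalerDr.
by rewrite addrACA addNr add0r.
Qed.

Lemma even_projection_bounded : bounded_op even_projection.
Proof.
apply: bounded_lin; last exact: bounded_id.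
by apply: bounded_lin => //; apply: bounded_id.
Qed.

Lemma parity_even_projection xi : V (even_projection xi) = even_projection xi.
Proof.
rewrite even_projectionE (opZ bV) (opD bV) -[V (V xi)]/((V \o V) xi) VV /=.
by rewrite addrC.
Qed.

Variable E : (H -> H) -> (H -> H).
Hypothesis condE :
  faithful_normal_conditional_expectation (Linfty pi) (even_Linfty U pi) E.
Hypothesis stateE :
  forall x, Linfty pi x -> vector_state Omega (E x) = vector_state Omega x.

(** Both E(x) Omega and the projection of x Omega are fixed by [V] and have the same inner products
    with even GNS vectors: the former by the bimodule property and invariance of the state, the
    latter because [V] is self-adjoint. Hence their difference vanishes. *)
Lemma expectation_even_projection :
  is_L2_implementation (Linfty pi) id Omega E even_projection.
Proof.
split=> [|x Mx]; first exact: even_projection_bounded.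
have [[_ EN] _ bimod _ _] := condE.
have NE := EN _ Mx.
have evenV b : alpha b = b -> V (pi b Omega) = pi b Omega by rewrite Vpi => ->.
have VE : V (E x Omega) = E x Omega.
  (* The operator [V] commutes with products of two generators, as the signs cancel, hence with all
     of [N]. *)
  have VEx : E x \o V = V \o E x.
    apply: (vn_generated_commute even_gens_bounded bV aV) NE =>
      _ [i [j [k [l ->]]]];
      by rewrite Vcomm rmorphM /= !alphaU mulrNN.
  by rewrite -[V (E x _)]/((V \o E x) Omega) -VEx /= VOmega.
have orthE b : alpha b = b ->
    inner (E x Omega) (pi b Omega) = inner (x Omega) (pi b Omega).
  move=> eb; have adj := adjoint_sym (pi_adjoint b).
  have esb : alpha (star b) = star b by rewrite star_alpha eb.
  have Nsb := even_Linfty_pi esb.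
  have N1 : even_Linfty U pi id by apply: vn_generated_id.
  rewrite -!adj -[pi _ (E x _)]/((pi (star b) \o E x \o id) Omega).
  rewrite -(bimod _ _ _ Nsb N1 Mx).
  apply: stateE; apply: vn_generated_comp => //; last first.
    exact: vn_generated_id.
  by apply: vn_generated_comp => //; apply: even_Linfty_sub.
apply/eqP; rewrite eq_sym -subr_eq0; apply/eqP.
apply: (dense_orthogonal pi_dense) => _ [a _ <-].
set w := E x Omega - even_projection (x Omega).
have Vw : V w = w by rewrite (opB bV) VE parity_even_projection.
have eb : alpha (a + alpha a) = a + alpha a by rewrite rmorphD /= alphaK addrC.
have wb : inner w (pi (a + alpha a) Omega) = 0.
  rewrite innerDl innerNl orthE // even_projectionE innerZl innerDl.
  by rewrite aV (evenV _ eb) -[_ * _]/(2^-1 *: (_ : C^o)) half_double subrr.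
(* As [V w = w], the vectors of [a] and [alpha a] have the same inner product with [w], so only the
   even part of [a] matters. *)
have : inner w (pi a Omega) *+ 2 = 0.
  rewrite -wb -[a in pi (a + _)]scale1r orbit_lin scale1r innerDr mulr2n.
  by rewrite -Vpi -aV Vw.
by move/eqP; rewrite mulrn_eq0 /= => /eqP.
Qed.

Lemma id_relative_compact (i0 : 'I_n) :
  relative_compacts (Linfty pi) E id Omega id.
Proof.
have M1 : Linfty pi id by apply: vn_generated_id.
have Mpi a : Linfty pi (pi a) by apply: vn_generated_gen; exists a.
split=> [|e e0]; first exact: bounded_id.
(* The identity lies in the span itself, so it is its own approximation for every [e]. *)
exists id; last by move=> xi; rewrite !fctE subrr normr0 mulr_ge0 // ltW.
(* Index 0 carries e_N, and the other [n] indices carry its conjugates by row [i0] of [U]. *)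
pose s (i : 'I_n.+1) : H -> H := if unlift ord0 i is Some j
  then pi (U i0 j) \o even_projection \o pi (star (U i0 j))
  else even_projection.
exists n.+1, (fun=> 1), s; split=> [i|].
  rewrite /s; case: unlift => [j|] /=.
    exists (pi (U i0 j)), (pi (star (U i0 j))), even_projection; split=> //.
    exact: expectation_even_projection.
  exists id, id, even_projection; split=> //.
  exact: expectation_even_projection.
apply/funext => xi; rewrite fct_sumE big_ord_recl /s unlift_none.
under eq_bigr do rewrite liftK.
(* Moving [V] past the odd element u^* changes its sign, which leaves u u^* (1 - V) / 2. *)
have step j : (1 *: (pi (U i0 j) \o even_projection \o pi (star (U i0 j)))) xi =
    2^-1 *: (pi (U i0 j * star (U i0 j)) (xi - V xi)).
  rewrite !fctE scale1r /= even_projectionE -[V (pi _ _)]/((V \o pi _) xi).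
  rewrite Vcomm star_alpha alphaU starN piN /= piM.
  set p := pi (U i0 j); set q := pi (star _).
  have bp : bounded_op p := pi_bounded _; have bq : bounded_op q := pi_bounded _.
  by rewrite /= (opB bq) !fctE (opZ bp) addrC (opB bp).
under eq_bigr do rewrite step.
rewrite -scaler_sumr.
have -> : \sum_(j < n) pi (U i0 j * star (U i0 j)) (xi - V xi) = xi - V xi.
  have := congr1 (fun a => pi a (xi - V xi)) (rel_UUs relU i0 i0).
  by rewrite eqxx pi1 pi_sum fct_sumE.
by rewrite fctE scale1r even_projectionE -scalerDr addrC addrA subrK half_double.
Qed.

End Expectation.
End Parity.

Lemma relative_Haagerup_even (i0 : 'I_n) (E : (H -> H) -> (H -> H)) :
  faithful_normal_conditional_expectation (Linfty pi) (even_Linfty U pi) E ->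
  (forall x, Linfty pi x -> vector_state Omega (E x) = vector_state Omega x) ->
  relative_Haagerup_property (Linfty pi) (even_Linfty U pi) E.
Proof.
move=> condE stateE.
have [alpha [sa aU]] := parity_ex polU.
have [V [bV aV VV VO Vpi]] := parity_op sa aU.
exists (vector_state Omega); split=> //; first exact: vector_state_faithful.
exists H, id, Omega; split; first exact: gns_Linfty.
(* The net has a single index, and its only map is the identity. *)
exists unit, (fun _ _ => True), (fun _ x => x); split.
- by split=> // *; exists tt.
- by move=> _; split=> // w sw; exists w.
- split; first by move=> _ m X _ posX.
  by exists 1 => _ x k _ bx; rewrite mul1r.
- by [].
- split=> //.
    by move=> x _ zeta B /nbhs_singleton Bx; exists tt.
  move=> _; exists id; first by split=> //; apply: bounded_id.
  by apply: (id_relative_compact sa aU bV aV VV VO) condE stateE i0 => a;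
    have [] := Vpi a.
Qed.

End GNS.

(** * The relative Haagerup property of the even inclusion *)

Local Open Scope complex_scope.

Theorem corollary9p8 (R : realType) (n : nat) (F : 'M[R[i]]_n) (c : R)
    (A AA : starAlg R[i]) (U : 'M[A]_n) (t : {bilinear A -> A -> AA})
    (Delta : {lrmorphism A -> AA}) (h : {scalar A})
    (H : hilbert R[i]) (pi : A -> (H -> H)) (Omega : H)
    (E : (H -> H) -> (H -> H)) :
  (2 <= n)%N ->
  c != 0 -> F *m map_mx conjC F = (c%:C)%:M ->
  is_Pol_OF F U ->
  is_tensor_product t ->
  is_comultiplication U t Delta ->
  is_haar_state t Delta h ->
  is_gns_star h pi Omega ->
  faithful_normal_conditional_expectation (Linfty pi) (even_Linfty U pi) E ->
  (forall x, Linfty pi x -> vector_state Omega (E x) = vector_state Omega x) ->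
  relative_Haagerup_property (Linfty pi) (even_Linfty U pi) E.
Proof.
move=> n2 c0 FF polU tensor_t comultD haar_h gns.
(* The inverse of F is its entrywise conjugate divided by [c]. *)
have unitF : F \in unitmx.
  have cC0 : c%:C != 0 by rewrite fmorph_eq0.
  have [] := @mulmx1_unit _ _ F ((c%:C)^-1 *: map_mx conjC F) => //.
  by rewrite -scalemxAr FF scale_scalar_mx mulVf.
(* The bound on [n] provides a row of [U], the one of index 0. *)
exact: (relative_Haagerup_even unitF polU tensor_t comultD haar_h gns
  (Ordinal (ltnW n2))).
Qed.
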